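(* Let $Y$ be a metrizable uniform space and let $X$ be a closed subspace of $Y$ with $|X|\ge 2$. Then there exists a positive linear extension operator $T:\mathbb{R}^{X\times X}\to\mathbb{R}^{Y\times Y}$ that preserves constant functions, bounded functions, continuous functions, pseudometrics, metrics, admissible metrics, dominating metrics, and uniformly dominating metrics, and that is continuous with respect to each of the following three topologies (taken simultaneously on the domain and on the range): the topology of point-wise convergence, the uniform topology, and the compact-open topology. Moreover, if the uniform space $Y$ is complete, then $T$ preserves complete continuous uniformly dominating metrics; and if $Y$ is totally bounded and $\dim(Y\setminus X)<\infty$, then $T$ preserves totally bounded pseudometrics.
   Context: A uniform space is called metrizable if its uniformity is generated by a metric. $Y$ carries the topology induced by its uniformity, and $X$ carries the inherited uniformity and topology. $\dim$ is covering dimension. For a space $Z$, $\mathbb{R}^Z$ is the linear space of all (not necessarily continuous) real-valued functions on $Z$. The topology of point-wise convergence is the Tychonoff product topology; the uniform topology is that of uniform convergence on $Z$; the compact-open topology on $\mathbb{R}^Z$ is understood as the topology of uniform convergence on compact subsets of $Z$. An operator $T:\mathbb{R}^{X\times X}\to\mathbb{R}^{Y\times Y}$ is positive if $T(p)\ge 0$ whenever $p\ge0$, and is an extension operator if $T(p)|_{X\times X}=p$ for all $p$. ''$T$ preserves'' a class of functions means that $T$ carries every function on $X\times X$ of this class to a function on $Y\times Y$ of the same class; a constant function is carried to the constant function with the same value. Metrics and pseudometrics are functions satisfying the usual axioms; they are not assumed to be continuous or related to the topology unless stated. A metric $d$ on a topological [resp. uniform] space $Z$ is dominating [resp. uniformly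 dominating] if the formal identity map from the metric space $(Z,d)$ to $Z$ is continuous [resp. uniformly continuous]. A metric is admissible if it is dominating and continuous (as a function on $Z\times Z$). A metric $d$ on $Z$ is complete if the metric space $(Z,d)$ is complete; a pseudometric $d$ on $Z$ is totally bounded if for every $\varepsilon>0$ the set $Z$ is covered by finitely many $d$-balls of radius $\varepsilon$. *)

(* Defs.v *)
From HB Require Import structures.
From mathcomp Require Import all_boot all_order all_algebra.
From mathcomp Require Import all_classical all_reals all_analysis.
Import Order.TTheory GRing.Theory Num.Theory.
Import numFieldNormedType.Exports.

Set Implicit Arguments.
Unset Strict Implicit.
Unset Printing Implicit Defensive.

Local Open Scope classical_set_scope.
Local Open Scope ring_scope.

Record is_pseudometric (R : realType) (Z : Type) (d : Z * Z -> R) : Prop := {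
  pseudometric_ge0 : forall x y, 0 <= d (x, y);
  pseudometric_refl : forall x, d (x, x) = 0;
  pseudometric_sym : forall x y, d (x, y) = d (y, x);
  pseudometric_triangle : forall y x z, d (x, z) <= d (x, y) + d (y, z)
}.

Record is_metric (R : realType) (Z : Type) (d : Z * Z -> R) : Prop := {
  metric_is_pseudometric :> is_pseudometric d;
  metric_separated : forall x y, d (x, y) = 0 -> x = y
}.

(* The metric space (Z, d). The alias carries the topology and the uniformity
   of d, independently of those that Z may already have. *)
Definition metric_space (R : realType) (Z : choiceType) (d : Z * Z -> R)
  (dm : is_metric d) : Type := Z.

Section metric_space_instances.
Variables (R : realType) (Z : choiceType) (d : Z * Z -> R) (dm : is_metric d).

HB.instance Definition _ := Choice.copy (metric_space dm) Z.

HB.instance Definition _ := @isMetric.Build R (metric_space dm)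
  (fun x y => d (x, y)) (pseudometric_refl dm) (metric_separated dm)
  (pseudometric_sym dm) (pseudometric_triangle dm).

End metric_space_instances.

Definition metrizable (R : realType) (Z : uniformType) : Prop :=
  exists (d : Z * Z -> R) (dm : is_metric d),
    @entourage Z = @entourage (metric_space dm).

Definition dominating_metric (R : realType) (Z : topologicalType)
    (d : Z * Z -> R) : Prop :=
  exists dm : is_metric d, continuous (id : metric_space dm -> Z).

Definition uniformly_dominating_metric (R : realType) (Z : uniformType)
    (d : Z * Z -> R) : Prop :=
  exists dm : is_metric d, unif_continuous (id : metric_space dm -> Z).

Definition admissible_metric (R : realType) (Z : topologicalType)
    (d : Z * Z -> R) : Prop :=
  dominating_metric d /\ continuous d.

(* [completeType] additionally demands a base point, and it is a structure
   rather than a property. *)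
Definition complete_uniformity (Z : uniformType) : Prop :=
  forall F : set_system Z, ProperFilter F -> cauchy F -> exists z : Z, F --> z.

Definition complete_metric (R : realType) (Z : choiceType)
    (d : Z * Z -> R) : Prop :=
  exists dm : is_metric d, complete_uniformity (metric_space dm).

Definition totally_bounded_uniformity (Z : uniformType) : Prop :=
  forall E : set (Z * Z), entourage E ->
    exists2 C : set Z, finite_set C & forall z, exists2 c, C c & E (c, z).

Definition totally_bounded_pseudometric (R : realType) (Z : Type)
    (d : Z * Z -> R) : Prop :=
  is_pseudometric d /\
  forall eps : R, 0 < eps ->
    exists2 C : set Z, finite_set C & forall z, exists2 c, C c & d (c, z) < eps.

Definition bounded_function (R : realType) (Z : Type) (f : Z -> R) : Prop :=
  exists M : R, forall z, `|f z| <= M.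

Definition open_cover (Z : topologicalType) (U : set (set Z)) : Prop :=
  U `<=` open /\ \bigcup_(A in U) A = setT.

Definition refines (Z : Type) (V U : set (set Z)) : Prop :=
  forall B, V B -> exists2 A, U A & B `<=` A.

(* Covering dimension in the Cech-Lebesgue sense (finite open covers): each
   point lies in at most n + 1 members of the refinement. *)
Definition covering_dim_le (Z : topologicalType) (n : nat) : Prop :=
  forall U : set (set Z), finite_set U -> open_cover U ->
    exists V : set (set Z), [/\ finite_set V, open_cover V, refines V U &
      forall z, ([set B | V B /\ B z] #<= `I_n.+1)%card].

Definition finite_covering_dim (Z : topologicalType) : Prop :=
  exists n : nat, covering_dim_le Z n.

Definition preserves (A B : Type) (P : A -> Prop) (Q : B -> Prop)
    (T : A -> B) : Prop :=
  forall p, P p -> Q (T p).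

(* Main.v *)
Require Import Defs.
From HB Require Import structures.
From mathcomp Require Import all_boot all_order all_algebra.
From mathcomp Require Import all_classical all_reals all_analysis.
From mathcomp Require Import ring lra.
From mathcomp Require Import measurable_realfun.
From mathcomp Require wochoice.
Import Order.TTheory GRing.Theory Num.Theory.
Import numFieldNormedType.Exports.

Set Implicit Arguments.
Unset Strict Implicit.
Unset Printing Implicit Defensive.

Local Open Scope classical_set_scope.
Local Open Scope ring_scope.

(** Let d be a metric of Y bounded by 1, and delta the distance to X. Every
    point y of Y gets a step function [sel y] on [0, 1), thought of as a
    random representative of y: a point of X represents itself, and a point y
    outside X is represented by an anchor, a point of X whose distance to y is
    at most 6 delta y. The operator averages p over these representatives,
    taken at the same parameter t for both points:
      T p (y, z) = \int_0^1 p (sel y t, sel z t) dt.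
    Linearity, positivity, bounds, constants and the axioms of a pseudometric
    pass from p to T p because they hold at each t, and T p extends p because
    [sel x] is constant for x in X.

    Anchors alone cannot separate the points outside X. So on [0, delta y / 2)
    the representative of y is not an anchor but a copy of y, in a copy of Y
    attached to X. First p is extended to the disjoint union X + Y: two copies
    have the distance d (y, z) p (a, b), where a and b are two fixed points of X,
    and a copy has the distance (p (x, a) + p (x, b)) / 2 to x ([psum]). This
    gives lower bounds for T p: by d (y, z) p (a, b) times half the smaller
    distance to X ([extend_ge_copies]), by |delta y - delta z| p (a, b) / 4
    ([extend_ge_diff]), and, as copies use at most half of the levels,
    by half the p-distance of some anchors of the two points
    ([extend_anchors]). Together they show that T p separates points, dominates
    and dominates uniformly when p does. If Y is complete, then a continuous,
    uniformly dominating metric is complete on Y.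

    The anchors come from a sequence of functions lam n on Y and anchors alpha
    n y: at the level t one uses the first n with t < lam n y. All that is
    needed, besides the proximity of the anchors, is that lam n is continuous
    outside X, that alpha n is locally constant where lam n is positive, and
    that every y outside X has some n with 1 < lam n y; then near y finitely
    many anchors are used, and [sel z] converges to [sel y] in probability as
    z tends to y. Such functions exist by Stone's construction of a discrete
    refinement ([anchored_exists]). It follows that T p is continuous when p
    is ([extend_continuous]), and that the points of a compact set K use
    anchors from a compact set only ([compact_anchors]); as T p is bounded on
    K by the values of p at these anchors, T is continuous for the
    compact-open topology, and likewise for the other two.

    If Y is totally bounded and the complement of X has finite dimension, then
    finite covers of bounded order with mesh 2^-k, used where delta is about 2^-k,
    provide anchors for which [sel y] has a bounded number of breakpoints
    ([anchored_multiplicity]). Such a step function is determined, up to a small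
    error in the mean, by finitely many of its values, and total boundedness
    passes from p to T p ([extend_totally_bounded]). *)

(** * Step functions on the unit interval *)

Section StepFunctions.
Variable R : realType.
Implicit Types (A : Type) (s : seq R) (t : R).

(** The list is neither sorted nor restricted to [0, 1): pairing two step
    functions then amounts to concatenating their lists, and composition with
    an arbitrary map keeps the list. *)
Definition breakpoints A s (f : R -> A) : Prop :=
  forall t t', 0 <= t -> t <= t' -> t' < 1 ->
    (forall b, b \in s -> ~~ (t < b <= t')) -> f t = f t'.

Definition step A (f : R -> A) : Prop := exists s, breakpoints s f.

Lemma breakpoints_pair A B s s' (f : R -> A) (g : R -> B) :
  breakpoints s f -> breakpoints s' g ->
  breakpoints (s ++ s') (fun t => (f t, g t)).
Proof.
move=> bf bg t t' t0 tt' t1 h; congr pair.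
  by apply: bf => // b bs; apply: h; rewrite mem_cat bs.
by apply: bg => // b bs; apply: h; rewrite mem_cat bs orbT.
Qed.

Lemma step_cst A (a : A) : step (fun=> a).
Proof. by exists [::]. Qed.

Lemma step_comp A B (h : A -> B) (f : R -> A) : step f -> step (fun t => h (f t)).
Proof. by move=> [s bf]; exists s => t t' *; congr h; exact: bf. Qed.

Lemma step_comp2 A B C (h : A -> B -> C) (f : R -> A) (g : R -> B) :
  step f -> step g -> step (fun t => h (f t) (g t)).
Proof.
move=> [s bf] [s' bg]; exists (s ++ s') => t t' t0 tt' t1 hb.
by have [-> ->] := breakpoints_pair bf bg t0 tt' t1 hb.
Qed.

Lemma step_itv (a b : R) : step (fun t => (a <= t < b)%R).
Proof.
exists [:: a; b] => t t' t0 tt' t1 h.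
have := h a; have := h b; rewrite !inE !eqxx orbT => /(_ isT) hb /(_ isT) ha.
case: (leP a t) ha hb => at_; case: (leP a t') => at'; 
  case: (ltP t b) => bt; case: (ltP t' b) => bt' //=; lra.
Qed.

(** Counting breakpoints writes an arbitrary step function as a function of a
    monotone map with finitely many values, which yields its measurability and
    its boundedness. *)
Lemma breakpoints_count A s (f : R -> A) t t' :
  breakpoints s f -> 0 <= t < 1 -> 0 <= t' < 1 ->
  count (fun b => b <= t) s = count (fun b => b <= t') s -> f t = f t'.
Proof.
move=> bf; wlog tt' : t t' / t <= t'.
  move=> H ht ht' c; case: (leP t t') => [|/ltW] tt'; first exact: H.
  exact/esym/H.
move=> /andP[t0 t1] /andP[t'0 t'1] c; apply: bf => // b bs.
apply/negP => /andP[tb bt'].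
have : (count (fun b => b <= t)%R s < count (fun b => b <= t')%R s)%N.
  elim: s bs {c} => //= c s IHs; rewrite inE => /orP[/eqP <-|/IHs h].
    rewrite bt' leNgt tb /= add0n add1n ltnS; apply: sub_count => x /= xt.
    exact: le_trans xt tt'.
  rewrite -addnS leq_add//.
  by case: (leP c t) => //= ct; rewrite (le_trans ct tt').
by rewrite c ltnn.
Qed.

Notation unit_itv := ([set` `[0%R, 1%R[] : set R).

Definition mean (f : R -> R) : R :=
  \int[@lebesgue_measure R]_(t in unit_itv) f t.

Lemma step_integrable (f : R -> R) : step f ->
  (@lebesgue_measure R).-integrable unit_itv (EFin \o f).
Proof.
move=> [s bf]; pose c t := count (fun b => b <= t) s.
have cN t : (c t <= size s)%N by exact: count_size.
have mc : measurable_fun unit_itv (fun t => (c t)%:R : R).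
  apply: nondecreasing_measurable => // t t' tt'; rewrite ler_nat.
  by apply: sub_count => b /= bt; exact: le_trans bt tt'.
apply: measurable_bounded_integrable => //.
- by rewrite /= lebesgue_measure_itv/= lte_fin ltr01 sube0 ltry.
- move=> _ Y mY.
  pose K := [set k : nat | exists2 t, unit_itv t & c t = k /\ Y (f t)].
  rewrite (_ : _ `&` _ =
      \bigcup_(k in K) (unit_itv `&` (fun t => (c t)%:R : R) @^-1` [set k%:R])).
    by apply: bigcup_measurable => k _; exact: mc.
  apply/seteqP; split => t /=.
    by move=> [ut Yt]; exists (c t) => //; exists t.
  move=> [k [t' ut' [ct' Yt']] [ut /eqP]]; rewrite eqr_nat => /eqP ct.
  split => //; rewrite (_ : f t = f t')//; apply: (breakpoints_count bf).
  + by move: ut; rewrite /= in_itv.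
  + by move: ut'; rewrite /= in_itv.
  + by rewrite -/(c t) ct -ct'.
- pose G k := if pselect (exists2 t, unit_itv t & c t = k) is left e
              then `|f (projT1 (cid2 e))| else 0.
  exists (\sum_(k < (size s).+1) G k); split; first exact: num_real.
  move=> x hx t ut /=; apply: le_trans (ltW hx).
  have G0 k : 0 <= G k by rewrite /G; case: pselect.
  have -> : `|f t| = G (c t).
    rewrite /G; case: pselect => [e|]; last by case; exists t.
    case: cid2 => t' ut' /= ct'; congr (`|_|); apply: (breakpoints_count bf) => //.
  have ct : (c t < (size s).+1)%N by rewrite ltnS.
  by rewrite (bigD1 (Ordinal ct))//= lerDl sumr_ge0.
Qed.

Lemma meanD (f g : R -> R) : step f -> step g ->
  mean (fun t => f t + g t) = mean f + mean g.
Proof. by move=> sf sg; rewrite /mean RintegralD//; exact: step_integrable. Qed.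

Lemma meanZ (k : R) (f : R -> R) : step f -> mean (fun t => k * f t) = k * mean f.
Proof. by move=> sf; rewrite /mean RintegralZl//; exact: step_integrable. Qed.

Lemma mean_cst (c : R) : mean (fun=> c) = c.
Proof.
rewrite /mean Rintegral_cst//= lebesgue_measure_itv/= lte_fin ltr01 sube0/=.
by rewrite mulr1.
Qed.

Lemma eq_mean (f g : R -> R) : (forall t, 0 <= t < 1 -> f t = g t) ->
  mean f = mean g.
Proof.
move=> fg; apply: eq_Rintegral => t; rewrite inE/= in_itv/= => ht; exact: fg.
Qed.

Lemma le_mean (f g : R -> R) : step f -> step g ->
  (forall t, 0 <= t < 1 -> f t <= g t) -> mean f <= mean g.
Proof.
move=> sf sg fg.
by apply: (le_Rintegral _ (step_integrable sf) (step_integrable sg)).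
Qed.

Lemma mean_ge0 (f : R -> R) : (forall t, 0 <= t < 1 -> 0 <= f t) -> 0 <= mean f.
Proof.
by move=> f0; apply: Rintegral_ge0 => t; rewrite /= in_itv; exact: f0.
Qed.

Lemma mean_le (f : R -> R) (c : R) : step f ->
  (forall t, 0 <= t < 1 -> f t <= c) -> mean f <= c.
Proof.
by move=> sf fc; rewrite -[leRHS]mean_cst; apply: le_mean => //; exact: step_cst.
Qed.

Lemma norm_mean_le (f : R -> R) : step f -> `|mean f| <= mean (fun t => `|f t|).
Proof. by move=> sf; apply: le_normr_Rintegral => //; exact: step_integrable. Qed.

Lemma mean_norm_le (f : R -> R) (c : R) : step f ->
  (forall t, 0 <= t < 1 -> `|f t| <= c) -> `|mean f| <= c.
Proof.
move=> sf fc; apply: (le_trans (norm_mean_le sf)).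
by apply: mean_le => //; exact: (step_comp (fun x : R => `|x|)).
Qed.

Lemma mean_sum (I : Type) (r : seq I) (F : I -> R -> R) :
  (forall i, step (F i)) ->
  step (fun t => \sum_(i <- r) F i t) /\
  mean (fun t => \sum_(i <- r) F i t) = \sum_(i <- r) mean (F i).
Proof.
move=> sF; elim: r => [|i r [IHs IHr]].
  rewrite (_ : (fun t => _) = fun=> 0).
    by rewrite mean_cst big_nil; split => //; exact: step_cst.
  by apply/funext => t; rewrite big_nil.
rewrite (_ : (fun t => _) = fun t => F i t + \sum_(i <- r) F i t).
  split; first exact: (step_comp2 (fun x y => x + y)).
  by rewrite meanD// big_cons IHr.
by apply/funext => t; rewrite big_cons.
Qed.

Lemma step_itvr (a b : R) : step (fun t => (a <= t < b)%R%:R : R).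
Proof. exact/(step_comp (fun x : bool => x%:R : R))/step_itv. Qed.

Lemma mean_itv (a b : R) : 0 <= a -> a <= b -> b <= 1 ->
  mean (fun t => (a <= t < b)%R%:R) = b - a.
Proof.
move=> a0 ab b1.
rewrite (@eq_mean _ (\1_([set` `[a, b[]))); last first.
  by move=> t _; rewrite indicE mem_setE in_itv.
rewrite /mean /Rintegral integral_indic// (_ : _ `&` _ = [set` `[a, b[]).
  rewrite /= lebesgue_measure_itv/= lte_fin; case: ltP => //= ba.
  have -> : a = b by apply/eqP; rewrite eq_le ab.
  by rewrite subrr.
apply/seteqP; split => t /=; first by case.
rewrite !in_itv/= => /andP[h1 h2]; rewrite h1 h2 (le_trans a0 h1).
by rewrite (lt_le_trans h2 b1).
Qed.

Lemma mean_itv_le (a b : R) : a <= b ->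
  mean (fun t => (a <= t < b)%R%:R) <= b - a.
Proof.
move=> ab; case: (leP b 0) => b0; last case: (leP 1 a) => a1.
- rewrite (@eq_mean _ (fun=> 0)) ?mean_cst ?subr_ge0// => t /andP[t0 t1].
  by rewrite [t < b]ltNge (le_trans b0 t0) andbF.
- rewrite (@eq_mean _ (fun=> 0)) ?mean_cst ?subr_ge0// => t /andP[t0 t1].
  by rewrite leNgt (lt_le_trans t1 a1).
- rewrite (@eq_mean _ (fun t => ((Num.max 0 a) <= t < (Num.min 1 b))%R%:R)).
    rewrite mean_itv ?le_max ?lexx ?ge_min ?lexx//.
      by rewrite lerB// ?ge_min ?le_max lexx orbT.
    by rewrite le_min ge_max ge_max ler01 (ltW a1) (ltW b0).
  by move=> t /andP[t0 t1]; rewrite ge_max lt_min t0 t1.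
Qed.

End StepFunctions.

(** * Systems of anchors for the points outside X *)

Section DistanceToSet.
Variables (R : realType) (Y : Type) (d : Y * Y -> R).
Hypotheses (dm : is_pseudometric d) (d1 : forall z, d z <= 1).
Implicit Types (A : set Y) (y z : Y).

(** The cap at 1 loses nothing, since d is bounded by 1, and it makes the
    distance to the empty set equal to 1. *)
Definition dist A y : R := inf ([set 1] `|` [set d (y, a) | a in A]).

Let dist_lb A y : has_lbound ([set 1] `|` [set d (y, a) | a in A]).
Proof. by exists 0 => _ [->//|[a _ <-]]; exact: pseudometric_ge0. Qed.

Lemma dist_geP A y c : c <= 1 -> (forall a, A a -> c <= d (y, a)) -> c <= dist A y.
Proof.
move=> c1 cA; apply: lb_le_inf; first by exists 1; left.
by move=> _ [->//|[a Aa <-]]; exact: cA.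
Qed.

Lemma dist_ge0 A y : 0 <= dist A y.
Proof. by apply: dist_geP => // a _; exact: pseudometric_ge0. Qed.

Lemma dist_le1 A y : dist A y <= 1.
Proof. by apply: ge_inf => //; left. Qed.

Lemma dist_le A y a : A a -> dist A y <= d (y, a).
Proof. by move=> Aa; apply: ge_inf => //; right; exists a. Qed.

Lemma dist0 A y : A y -> dist A y = 0.
Proof.
move=> Ay; apply/eqP; rewrite eq_le dist_ge0 andbT.
by rewrite (le_trans (dist_le _ Ay))// pseudometric_refl.
Qed.

Lemma dist_ltP A y c : c <= 1 \/ A !=set0 -> dist A y < c ->
  exists2 a, A a & d (y, a) < c.
Proof.
move=> cA /inf_lt [|_ [->|[a Aa <-]] hc].
- by exists 1; left.
- case: cA => [|[a Aa]]; first by move=> /(lt_le_trans hc); rewrite ltxx.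
  by exists a => //; exact: le_lt_trans hc.
- by exists a.
Qed.

Lemma dist_lip A y z : dist A y <= dist A z + d (y, z).
Proof.
rewrite -lerBlDr; apply: dist_geP.
  rewrite lerBlDr (le_trans (dist_le1 _ _))// lerDl; exact: pseudometric_ge0.
move=> a Aa; rewrite lerBlDl (le_trans (dist_le _ Aa))//.
exact: pseudometric_triangle.
Qed.

Lemma dist_lip_norm A y z : `|dist A y - dist A z| <= d (y, z).
Proof.
rewrite ler_norml; have := dist_lip A y z; have := dist_lip A z y.
by rewrite (pseudometric_sym dm z y); lra.
Qed.

End DistanceToSet.

Section Selectors.
Variables (R : realType) (Y : choiceType) (d : Y * Y -> R) (X : set Y).
Hypotheses (dm : is_pseudometric d) (d1 : forall z, d z <= 1).

Local Notation delta := (dist d X).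

(** The functions lam n compete for y at each level t in [0, 1): the first n
    with t < lam n y wins, and y is then represented by the anchor alpha n y.
    By [anchored_cover] some index beats all levels at y, hence near y, so that
    only the finitely many indices before it matter there; this is why
    [anchored_local] can take the place of local finiteness. *)
Record anchored (lam : nat -> Y -> R) (alpha : nat -> Y -> X) : Prop := {
  anchored_continuous : forall n y, ~ X y -> forall e, 0 < e ->
    exists2 r, 0 < r & forall z, d (y, z) < r -> `|lam n z - lam n y| < e;
  anchored_near : forall n y, ~ X y -> 0 < lam n y ->
    d (y, set_val (alpha n y)) <= 6 * delta y;
  anchored_local : forall n y, ~ X y -> exists2 r, 0 < r &
    forall z z', d (y, z) < r -> d (y, z') < r ->
      0 < lam n z -> 0 < lam n z' -> alpha n z = alpha n z';
  anchored_cover : forall y, ~ X y -> exists n, 1 < lam n y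
}.

Hypothesis Xpos : forall y, ~ X y -> 0 < delta y.
Variable x0 : X.

Let anchorP c : exists x : X, ~ X c -> d (c, set_val x) < 2 * delta c.
Proof.
have [Xc|Xc] := pselect (X c); first by exists x0.
have dc := Xpos Xc.
have [||a Xa da] := @dist_ltP _ _ _ d1 X c (2 * delta c).
- by right; exists (set_val x0); exact: set_valP.
- lra.
- by exists (SigSub (mem_set Xa)).
Qed.

(** Stone's argument. The balls B c of radius delta c / 4 around points c outside
    X cover the complement of X; assign y to the first ball containing it, for
    a well-order P of Y. The points assigned to c that are 2^-n-deep inside
    B c form E n c. For fixed n the sets E n c are at mutual distance at least
    2^-n, so that a slight thickening of them is a discrete family, and a single
    function lam n can serve all of them. *)
Lemma anchored_exists : exists lam alpha, anchored lam alpha.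
Proof.
have [anc ancP] := choice anchorP.
have [P wP] := wochoice.well_ordering_principle Y.
have Panti : antisymmetric P.
  have Pwo : wochoice.wo_chain P (mem predT) by move=> A _; exact: wP.
  by move=> u v; exact: (wochoice.wo_chain_antisymmetric Pwo).
pose B c y := ~ X c /\ d (c, y) < delta c / 4.
pose E n c y := [/\ ~ X c, forall z, d (y, z) < 2^-1 ^+ n -> B c z &
                   forall c', B c' y -> P c c'].
have Esep n c c' y z : E n c y -> E n c' z -> d (y, z) < 2^-1 ^+ n -> c = c'.
  move=> [Xc Bc Pc] [Xc' Bc' Pc'] yz; apply: Panti; rewrite Pc ?Pc'//.
    exact: Bc.
  by apply: Bc'; rewrite (pseudometric_sym dm).
have e0 n : 0 < 2^-1 ^+ n :> R by rewrite exprn_gt0.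
have e1 n : 2^-1 ^+ n <= 1 :> R by rewrite exprn_ile1 ?invr_ge0 ?invf_le1 ?ler1n.
pose En n := [set y | exists c, E n c y].
(* positive exactly at distance less than 2^-n / 4 from En n *)
pose lam n y := 2 - 8 / 2^-1 ^+ n * dist d (En n) y.
have lamP n y : 0 < lam n y -> exists c, exists2 z, E n c z & d (y, z) < 2^-1 ^+ n / 4.
  move=> l0; have [||z [c Ec] dz] := @dist_ltP _ _ _ d1 (En n) y (2^-1 ^+ n / 4).
  - by left; have := e1 n; have := e0 n; lra.
  - move: l0; rewrite /lam -mulrA [_^-1 * _]mulrC => l0.
    have : dist d (En n) y / 2^-1 ^+ n < 4^-1 by lra.
    by rewrite ltr_pdivrMr// mulrC.
  - by exists c, z.
have /choice[cen cenP] (ny : nat * Y) : exists c, 0 < lam ny.1 ny.2 ->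
    exists2 z, E ny.1 c z & d (ny.2, z) < 2^-1 ^+ ny.1 / 4.
  have [/lamP[c h]|h] := boolP (0 < lam ny.1 ny.2); first by exists c.
  by exists ny.2.
exists lam, (fun n y => anc (cen (n, y))); split.
- move=> n y Xy e e_gt0; exists (e * (2^-1 ^+ n / 8)).
    by rewrite mulr_gt0// divr_gt0.
  move=> z yz; rewrite (_ : _ - _ =
    8 / 2^-1 ^+ n * (dist d (En n) y - dist d (En n) z)); last first.
    by rewrite /lam; set k := 8 / _; ring.
  rewrite normrM gtr0_norm ?divr_gt0// mulrC -ltr_pdivlMr ?divr_gt0//.
  rewrite invf_div; apply: le_lt_trans yz; exact: dist_lip_norm.
- move=> n y Xy l0; have [z [Xc Bc _] dz] := cenP (n, y) l0.
  have [_ By] : B (cen (n, y)) y.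
    apply: Bc; rewrite (pseudometric_sym dm) (lt_le_trans dz)//=.
    by have := e0 n; lra.
  have := ancP _ Xc; set x := anc _; set c := cen _ in By *.
  have := dist_lip dm X c y; have := Xpos Xc.
  have := pseudometric_triangle dm c y (set_val x).
  have := Xpos Xy; rewrite (pseudometric_sym dm y c); lra.
- move=> n y Xy; exists (2^-1 ^+ n / 4) => [|z z' yz yz' lz lz'].
    by rewrite divr_gt0.
  congr anc; have [u Eu du] := cenP (n, z) lz; have [u' Eu' du'] := cenP (n, z') lz'.
  apply: (Esep n _ _ _ _ Eu Eu'); rewrite /= in du du'.
  have := pseudometric_triangle dm z u u'; have := pseudometric_triangle dm z' z u'.
  have := pseudometric_triangle dm y z z'.
  rewrite (pseudometric_sym dm u z) (pseudometric_sym dm z y); lra.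
- move=> y Xy.
  have [|c [[/asboolP[Xc Bc] Pc] _]] := wP (fun c => `[<B c y>]).
    by exists y; apply/asboolP; split => //; rewrite pseudometric_refl// divr_gt0// Xpos.
  have [n hn] : exists n, 2^-1 ^+ n < delta c / 4 - d (c, y).
    have h : 0 < delta c / 4 - d (c, y) by lra.
    exists (Num.bound (delta c / 4 - d (c, y))^-1).
    rewrite -[ltRHS]invrK exprVn ltf_pV2 ?posrE ?invr_gt0 ?exprn_gt0//.
    rewrite (lt_le_trans (archi_boundP _)) ?invr_ge0 ?ltW//.
    by rewrite -natrX ltr_nat ltn_expl.
  exists n; rewrite /lam dist0//; first by lra.
  exists c; split => // [z yz|c' Bc'].
    split => //; have := pseudometric_triangle dm y c z; lra.
  by apply: Pc; apply/asboolP.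
Qed.

End Selectors.

(** * Anchors of bounded multiplicity *)

Section BigMax.
Variables (R : realType) (T : eqType).
Implicit Types (s : seq T) (u v : T -> R).

Lemma bigmax_lip s u v r : 0 <= r -> (forall i, `|u i - v i| <= r) ->
  `|\big[Num.max/0]_(i <- s) u i - \big[Num.max/0]_(i <- s) v i| <= r.
Proof.
move=> r0 uv; elim: s => [|i s]; first by rewrite !big_nil subrr normr0.
rewrite !big_cons; set a := bigop _ _ _; set b := bigop _ _ _.
have := uv i; rewrite !ler_norml => /andP[h1 h2] /andP[h3 h4].
by case: (leP (u i) a) => ?; case: (leP (v i) b) => ?; apply/andP; split; lra.
Qed.

Lemma bigmax_ge s u i : i \in s -> u i <= \big[Num.max/0]_(i <- s) u i.
Proof.
elim: s => // j s IHs; rewrite inE big_cons le_max => /orP[/eqP ->|/IHs ->].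
  by rewrite lexx.
by rewrite orbT.
Qed.

Lemma bigmax_eq s u : 0 < \big[Num.max/0]_(i <- s) u i ->
  exists2 i, i \in s & u i = \big[Num.max/0]_(i <- s) u i.
Proof.
elim: s => [|j s IHs]; first by rewrite big_nil ltxx.
rewrite big_cons; case: (leP (u j)) => [_ /IHs [i si ui]|_ _].
  by exists i => //; rewrite inE si orbT.
by exists j => //; exact: mem_head.
Qed.

End BigMax.

Lemma ratio_near (R : realType) (u U u' U' r : R) :
  0 <= u -> u <= U -> 0 < U -> r <= U / 2 -> `|u' - u| <= r -> `|U' - U| <= r ->
  `|u' / U' - u / U| <= 4 * r / U.
Proof.
move=> u0 uU U0 rU hu hU.
have /andP[h1 h2] : - r <= u' - u <= r by rewrite -ler_norml.
have /andP[h3 h4] : - r <= U' - U <= r by rewrite -ler_norml.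
have U'0 : U / 2 <= U' by lra.
have U'p : 0 < U' by lra.
have -> : u' / U' - u / U = ((u' - u) * U - u * (U' - U)) / (U' * U).
  by field; rewrite !gt_eqF.
rewrite normrM normfV (gtr0_norm (mulr_gt0 _ _))// ler_pdivrMr ?mulr_gt0//.
have -> : 4 * r / U * (U' * U) = 4 * r * U' by field; rewrite gt_eqF.
rewrite ler_norml; apply/andP; split; nra.
Qed.

Lemma min_near (R : realType) (a b a' b' e : R) :
  `|a' - a| < e -> `|b' - b| < e -> `|Num.min a' b' - Num.min a b| < e.
Proof.
rewrite !ltr_norml => /andP[h1 h2] /andP[h3 h4].
by case: (leP a b) => ?; case: (leP a' b') => ?; apply/andP; split; lra.
Qed.

Definition multiplicity_le (R : realType) (Y : Type) (X : set Y)
    (lam : nat -> Y -> R) (N : nat) : Prop :=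
  forall y, ~ X y -> exists2 ns : seq nat, (size ns <= N)%N &
    forall n, 0 < lam n y -> n \in ns.

Section FiniteCovers.
Variables (R : realType) (Y : choiceType) (d : Y * Y -> R) (X : set Y).
Hypotheses (dm : is_pseudometric d) (d1 : forall z, d z <= 1).
Local Notation delta := (dist d X).
Hypothesis Xpos : forall y, ~ X y -> 0 < delta y.
Variable x0 : X.

Definition finite_small_cover (N : nat) (e : R) (Vs : seq (set Y)) : Prop :=
  [/\ forall V, V \in Vs -> forall y, V y ->
        ~ X y /\ exists2 r, 0 < r & forall z, d (y, z) < r -> V z,
      forall y, ~ X y -> exists2 V, V \in Vs & V y,
      forall V, V \in Vs -> forall y z, V y -> V z -> d (y, z) < 2 * e &
      forall y, (count (fun V => `[< V y >]) Vs <= N)%N].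

Let anchorP (e : R) (V : set Y) : exists x : X, 0 < e ->
  (forall y z, V y -> V z -> d (y, z) < 2 * e) ->
  forall y, V y -> d (y, set_val x) <= delta y + 5 * e.
Proof.
have [[v Vv]|V0] := pselect (V !=set0); last first.
  by exists x0 => _ _ y Vy; exfalso; apply: V0; exists y.
have [e0|e0] := ltP 0 e; last by exists x0.
have [||a Xa da] := @dist_ltP _ _ _ d1 X v (delta v + e).
- by right; exists (set_val x0); exact: set_valP.
- by rewrite ltrDl.
exists (SigSub (mem_set Xa)) => _ Vd y Vy.
have : d (y, v) < 2 * e by exact: Vd.
have := pseudometric_triangle dm v y a; have := dist_lip dm X v y.
by rewrite (pseudometric_sym dm v y) /=; change (set_val _) with a; lra.
Qed.

(** The cover of mesh 2^-k is used only in the shell 1 < 2^k delta y < 8, where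
    its mesh is comparable to the distance to X. A point lies in at most three
    such shells, hence the bound 3 N. Dividing the depth u V y of y in V by the
    largest depth U k y ensures that some index exceeds the level 1. The pairs
    (level of the cover, position in the cover) are encoded as numbers. *)
Lemma anchored_multiplicity (N : nat) :
  (forall e, 0 < e -> exists Vs, finite_small_cover N e Vs) ->
  exists (lam : nat -> Y -> R) (alpha : nat -> Y -> X),
    anchored d lam alpha /\ multiplicity_le X lam (3 * N).
Proof.
move=> covers.
have e0 k : 0 < 2^-1 ^+ k :> R by rewrite exprn_gt0.
have eV k : 2^-1 ^+ k = (2 ^+ k)^-1 :> R by rewrite exprVn.
have p0 k : 0 < 2 ^+ k :> R by rewrite exprn_gt0.
have /choice[Vs VsP] k := covers (2^-1 ^+ k) (e0 k).
have /choice[anc ancP] (kj : nat * nat) :=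
  anchorP (2^-1 ^+ kj.1) (nth set0 (Vs kj.1) kj.2).
pose u (V : set Y) y := dist d (~` V) y.
pose U k y := \big[Num.max/0]_(V <- Vs k) u V y.
pose bump k y := Num.min (delta y * 2 ^+ k - 1) (8 - delta y * 2 ^+ k).
pose lam n y := if @pickle_inv (nat * nat)%type n is Some (k, j) then
  Num.min (2 * (u (nth set0 (Vs k) j) y / U k y)) (bump k y) else 0.
pose alpha n (y : Y) := if @pickle_inv (nat * nat)%type n is Some kj then anc kj else x0.
have u0 V y : 0 <= u V y by exact: dist_ge0.
have uV k V y : V \in Vs k -> V y -> 0 < u V y.
  move=> kV Vy; have [oV _ _ _] := VsP k.
  have [_ [r r0 rV]] := oV _ kV _ Vy.
  apply: (@lt_le_trans _ _ (Num.min r 1)); first by rewrite lt_min r0 ltr01.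
  apply: dist_geP => [|a Va]; first by rewrite ge_min lexx orbT.
  by rewrite ge_min; case: leP => //= /rV.
have Upos k y : ~ X y -> 0 < U k y.
  move=> Xy; have [_ cV _ _] := VsP k; have [V kV Vy] := cV _ Xy.
  by apply: lt_le_trans (uV _ _ _ kV Vy) _; exact: (bigmax_ge (fun V => u V y)).
have lam_gt0 n y : ~ X y -> 0 < lam n y -> exists kj : nat * nat,
    [/\ @pickle_inv (nat * nat)%type n = Some kj, (kj.2 < size (Vs kj.1))%N,
        nth set0 (Vs kj.1) kj.2 y, 1 < delta y * 2 ^+ kj.1
        & delta y * 2 ^+ kj.1 < 8].
  move=> Xy; rewrite /lam; case: pickle_inv => [[k j]|]; last by rewrite ltxx.
  rewrite !lt_min subr_gt0 subr_gt0 => /and3P[h1 h2 h3]; exists (k, j) => /=.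
  have Vy : nth set0 (Vs k) j y.
    apply: contrapT => nVy; move: h1; rewrite /u dist0//.
    by rewrite mul0r mulr0 ltxx.
  split => //; rewrite ltnNge; apply/negP => kj.
  by move: Vy; rewrite nth_default.
exists lam, alpha; split; first split.
- move=> n y Xy e e_gt0; rewrite /lam; case: pickle_inv => [[k j]|]; last first.
    by exists 1 => // z _; rewrite subrr normr0.
  set V := nth _ _ _; have Uy := Upos k y Xy.
  pose r := Num.min (U k y / 2) (e * U k y / 16).
  have r0 : 0 < r by rewrite lt_min !divr_gt0// mulr_gt0.
  have lipu W z : `|u W z - u W y| <= d (y, z).
    by rewrite distrC; exact: dist_lip_norm.
  have ratio z : d (y, z) < r -> `|u V z / U k z - u V y / U k y| < e / 2.
    move=> /ltW yzr; have [Vk|->] : V \in Vs k \/ V = set0.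
    - rewrite /V; case: (ltnP j (size (Vs k))) => h; first by left; exact: mem_nth.
      by right; rewrite nth_default.
    - apply: (@le_lt_trans _ _ (4 * r / U k y)).
        apply: ratio_near => //.
        + exact: (bigmax_ge (fun W => u W y)).
        + by rewrite /r ge_min lexx.
        + exact: le_trans yzr.
        + by apply: bigmax_lip => [|W]; [exact: ltW|exact: le_trans (lipu _ _) yzr].
      rewrite ltr_pdivrMr//; have : r <= e * U k y / 16 by rewrite /r ge_min lexx orbT.
      by have := mulr_gt0 e_gt0 Uy; lra.
    - by rewrite /u !dist0// !mul0r subrr normr0 divr_gt0.
  exists (Num.min r (e / 2 ^+ k)); first by rewrite lt_min r0 divr_gt0.
  move=> z; rewrite lt_min => /andP[/ratio yzr yze].
  have yze' : `|delta z * 2 ^+ k - delta y * 2 ^+ k| < e.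
    rewrite -mulrBl normrM [X in _ * X]gtr0_norm// -ltr_pdivlMr//.
    by apply: le_lt_trans yze; rewrite distrC; exact: dist_lip_norm.
  apply: min_near; last apply: min_near.
  + by rewrite -mulrBr normrM gtr0_norm// mulrC -ltr_pdivlMr.
  + by rewrite opprB addrA subrK.
  + rewrite opprB [X in `|X|](_ : _ = delta y * 2 ^+ k - delta z * 2 ^+ k); last by ring.
    by rewrite distrC.
- move=> n y Xy l0; have [kj [nk ks Vy h1 h2]] := lam_gt0 _ _ Xy l0.
  rewrite /alpha nk; have [_ _ dV _] := VsP kj.1.
  have := ancP kj (e0 _) (dV _ (mem_nth _ ks)) _ Vy.
  move=> /le_trans; apply; have : 2^-1 ^+ kj.1 < delta y by rewrite eV -div1r ltr_pdivrMr.
  lra.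
- by move=> n y _; exists 1 => // z z' _ _ _ _; rewrite /alpha; case: pickle_inv.
- move=> y Xy; have dy := Xpos Xy; have dy1 : delta y <= 1 by exact: dist_le1.
  have exk : exists k, 2 < delta y * 2 ^+ k.
    exists (Num.bound (2 / delta y)).
    rewrite mulrC -ltr_pdivrMr// (lt_trans (archi_boundP _)) ?divr_ge0 ?ltW//.
    by rewrite -natrX ltr_nat ltn_expl.
  (* the least such k satisfies 2 < 2^k delta y <= 4, well inside the shell *)
  case: (ex_minnP exk) => -[|k] hk mink; first by move: hk; rewrite expr0; lra.
  have [_ cV _ _] := VsP k.+1.
  have /bigmax_eq[V kV uVU] := Upos k.+1 y Xy.
  exists (pickle (k.+1, index V (Vs k.+1))); rewrite /lam pickleK_inv nth_index//.
  have hk' : delta y * 2 ^+ k <= 2.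
    by rewrite leNgt; apply/negP => /mink; rewrite ltnn.
  rewrite uVU divff ?gt_eqF ?Upos// mulr1 !lt_min; move: hk; rewrite exprS => hk.
  by apply/and3P; split; lra.
- move=> y Xy; have dy := Xpos Xy.
  have exk : exists k, 1 < delta y * 2 ^+ k.
    exists (Num.bound (1 / delta y)).
    rewrite mulrC -ltr_pdivrMr// (lt_trans (archi_boundP _)) ?divr_ge0 ?ltW//.
    by rewrite -natrX ltr_nat ltn_expl.
  case: (ex_minnP exk) => k1 hk1 mink.
  pose s k := [seq pickle (k, j) | j <- iota 0 (size (Vs k)) & `[< nth set0 (Vs k) j y >]].
  have ss k : (size (s k) <= N)%N.
    have [_ _ _ cV] := VsP k; apply: leq_trans (cV y).
    rewrite size_map size_filter -[X in (_ <= count _ X)%N](mkseq_nth set0 (Vs k)).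
    by rewrite count_map.
  exists (s k1 ++ s k1.+1 ++ s k1.+2).
    by rewrite !size_cat !mulSn mul0n addn0 !leq_add.
  move=> n l0; have [[k j] /= [nk ks Vy h1 h2]] := lam_gt0 _ _ Xy l0.
  have sn : n \in s k.
    apply/mapP; exists j; last by have := @pickle_invK (nat * nat)%type n; rewrite /oapp nk.
    by rewrite mem_filter mem_iota /= add0n ks andbT; exact/asboolP.
  rewrite !mem_cat; have k1k : (k1 <= k)%N by exact: mink.
  have kk1 : (k < k1.+3)%N.
    rewrite ltnNge; apply/negP => k3.
    have : 2 ^+ k1.+3 <= 2 ^+ k :> R by rewrite ler_eXn2l// ltr1n.
    rewrite -(ler_pM2l dy) !exprS => h; lra.
  have : k \in iota k1 3 by rewrite mem_iota k1k addn3.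
  by rewrite !inE => /or3P[] /eqP <-; rewrite sn ?orbT.
Qed.

End FiniteCovers.

(** * Metrized uniformities and covering dimension *)

Lemma set_val_inj (T : Type) (A : set T) : injective (set_val : A -> T).
Proof.
move=> [x xA] [y yA]; rewrite !set_valE /= => xy; subst y.
by congr exist; exact: bool_irrelevance.
Qed.

Section MetrizedUniformity.
Variables (R : realType) (Y : uniformType) (d : Y * Y -> R).
Hypothesis dm : is_pseudometric d.

Definition metrizes : Prop := forall E : set (Y * Y),
  entourage E <-> exists2 r, 0 < r & forall y z, d (y, z) < r -> E (y, z).

Hypothesis dY : metrizes.

Lemma metrizes_nbhs (y : Y) (A : set Y) :
  nbhs y A <-> exists2 r, 0 < r & forall z, d (y, z) < r -> A z.
Proof.
rewrite -nbhs_entourageE; split.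
  move=> [E /dY[r r0 rE] EA]; exists r => // z /rE Eyz.
  by apply: EA; rewrite /xsection/= inE.
move=> [r r0 rA]; exists [set yz | d yz < r]; first by apply/dY; exists r.
by move=> z; rewrite /xsection/= inE; exact: rA.
Qed.

Lemma metrizes_nbhs_sub (X : set Y) (x : X) (A : set X) :
  nbhs x A <->
  exists2 r, 0 < r & forall z : X, d (set_val x, set_val z) < r -> A z.
Proof.
split.
  move=> [_ [[W oW <-] Wx WA]].
  have /metrizes_nbhs[r r0 rW] : nbhs (set_val x) W by exact: open_nbhs_nbhs.
  by exists r => // z /rW Wz; exact: WA.
move=> [r r0 rA].
have : nbhs (set_val x) [set z | d (set_val x, z) < r].
  by apply/metrizes_nbhs; exists r.
move=> /(@initial_continuous X Y set_val x) nA.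
have : nbhs x (set_val @^-1` [set z | d (set_val x, z) < r]) by exact: nA.
by apply: filterS => z; exact: rA.
Qed.

Lemma metrizes_entourage_sub (X : set Y) (E : set (X * X)) :
  entourage E <-> exists2 r, 0 < r &
    forall y z : X, d (set_val y, set_val z) < r -> E (y, z).
Proof.
split.
  by move=> [W /dY[r r0 rW] WE]; exists r => // y z h; apply: WE; exact: rW.
move=> [r r0 rE]; exists [set yz | d yz < r]; first by apply/dY; exists r.
by move=> [y z]; exact: rE.
Qed.

Lemma metrizes_closed_dist (X : set Y) (y : Y) :
  closed X -> ~ X y -> 0 < dist d X y.
Proof.
move=> Xcl Xy.
have /metrizes_nbhs[r r0 rX] : nbhs y (~` X).
  by apply: open_nbhs_nbhs; split => //; exact: closed_openC.
apply: (@lt_le_trans _ _ (Num.min r 1)); first by rewrite lt_min r0 ltr01.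
apply: dist_geP => //; first by rewrite ge_min lexx orbT.
by move=> a Xa; rewrite ge_min; case: leP => //= /rX.
Qed.

End MetrizedUniformity.

Section CoveringDimension.
Variables (R : realType) (Y : uniformType) (d : Y * Y -> R) (X : set Y).
Hypothesis dm : is_pseudometric d.
Hypothesis dY : metrizes d.
Hypothesis Xcl : closed X.
Variable dimX : nat.
Hypotheses (Ytb : totally_bounded_uniformity Y)
  (Xdim : covering_dim_le (set_type (~` X)) dimX).

Local Notation delta := (dist d X).
Local Notation CX := (set_type (~` X)).

Let Xpos y : ~ X y -> 0 < delta y. Proof. exact: metrizes_closed_dist. Qed.

Lemma size_le_card (T : eqType) (s : seq T) n :
  uniq s -> ([set` s] #<= `I_n)%card -> (size s <= n)%N.
Proof.
move=> us /pcard_leP[f]; rewrite -(size_iota 0 n) -(size_map f).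
apply: uniq_leq_size.
  by rewrite map_inj_in_uniq// => a b sa sb; apply: inj; rewrite inE.
move=> _ /mapP[a sa ->]; rewrite mem_iota /= add0n.
exact: (@funS _ _ _ _ f a).
Qed.

(** Total boundedness provides a finite cover by balls, and it is to this finite
    cover that the hypothesis on the dimension applies. *)
Lemma small_cover (e : R) : 0 < e -> exists Vs, finite_small_cover d X dimX.+1 e Vs.
Proof.
move=> e0.
have [C finC Ccov] : exists2 C : set Y, finite_set C &
    forall z, exists2 c, C c & d (c, z) < e.
  by apply: (Ytb (E := [set yz | d yz < e])); apply/dY; exists e.
pose ball c : set CX := [set z | d (c, set_val z) < e].
have [||V [finV [oV covV] refV ordV]] := Xdim (U := [set ball c | c in C]).
- exact: finite_image.
- split; last first.
    apply/seteqP; split => // z _; have [c Cc dc] := Ccov (set_val z).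
    by exists (ball c) => //; exists c.
  move=> _ [c Cc <-]; rewrite openE => z bz; apply/(metrizes_nbhs_sub dY).
  exists (e - d (c, set_val z)); first by rewrite subr_gt0.
  move=> w zw; have := pseudometric_triangle dm (set_val z) c (set_val w).
  by rewrite /ball /=; lra.
have /finite_seqP[s0 Vs0] := finV; pose s := undup s0.
have sV B : (B \in s) = (B \in V) by rewrite mem_undup Vs0 mem_setE.
pose up (B : set CX) : set Y := [set set_val z | z in B].
exists [seq up B | B <- s]; split.
- move=> V0 /mapP[B]; rewrite sV inE => VB -> _ [z Bz <-].
  have zX : (~` X) (set_val z) by exact: set_valP.
  split => //; have /(metrizes_nbhs_sub dY)[r r0 rB] : nbhs z B.
    by apply: open_nbhs_nbhs; split => //; exact: oV.
  exists (Num.min r (delta (set_val z))); first by rewrite lt_min r0 Xpos.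
  move=> w; rewrite lt_min => /andP[wr wd].
  have Xw : ~ X w by move=> /(dist_le dm (set_val z)); rewrite leNgt wd.
  by exists (SigSub (mem_set Xw : w \in ~` X)) => //; exact: rB.
- move=> y Xy; pose z : CX := SigSub (mem_set Xy : y \in ~` X).
  have [B VB Bz] : (\bigcup_(B in V) B) z by rewrite covV.
  exists (up B); last by exists z.
  by apply: map_f; rewrite sV inE.
- move=> V0 /mapP[B]; rewrite sV inE => VB -> _ _ [z Bz <-] [w Bw <-].
  have [_ [c Cc <-] Bc] := refV _ VB.
  have := Bc _ Bz; have := Bc _ Bw; rewrite /ball/=.
  have := pseudometric_triangle dm c (set_val z) (set_val w).
  by rewrite (pseudometric_sym dm _ c); lra.
- move=> y; rewrite count_map; have [Xy|Xy] := pselect (X y).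
    rewrite (@eq_count _ _ pred0) ?count_pred0// => B /=.
    by apply/asboolP => -[z _ zy]; have : (~` X) (set_val z) by [exact: set_valP]; rewrite zy.
  pose z : CX := SigSub (mem_set Xy : y \in ~` X).
  rewrite -size_filter; apply: size_le_card; first exact/filter_uniq/undup_uniq.
  apply: card_le_trans (ordV z); apply: subset_card_le => B /=.
  rewrite mem_filter sV => /andP[/asboolP[w Bw wy] /set_mem VB]; split => //.
  by rewrite (_ : z = w)//; apply: set_val_inj; rewrite wy set_valE.
Qed.

End CoveringDimension.

(** * The extension operator *)

Section Operator.
Variables (R : realType) (Y : choiceType) (d : Y * Y -> R) (X : set Y).
Hypotheses (dm : is_pseudometric d) (d1 : forall z, d z <= 1).
Local Notation delta := (dist d X).
Hypothesis Xpos : forall y, ~ X y -> 0 < delta y.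
Variables (lam : nat -> Y -> R) (alpha : nat -> Y -> X).
Hypothesis anch : anchored d lam alpha.
Variables a b : X.

Definition first_above y t : nat :=
  if pselect (exists n, t < lam n y) is left e then ex_minn e else 0%N.

Lemma first_aboveP y t : ~ X y -> t < 1 ->
  t < lam (first_above y t) y /\ forall n, t < lam n y -> (first_above y t <= n)%N.
Proof.
move=> Xy t1; rewrite /first_above; case: pselect => [e|[]].
  by case: ex_minnP => n ln minn; split.
by have [n ln] := anchored_cover anch Xy; exists n; exact: lt_trans ln.
Qed.

(** An index N beating all levels at y confines the competition to the
    indices up to N. *)
Lemma first_above_eq N y t z t' : ~ X y -> ~ X z -> t < 1 -> t' < 1 ->
  1 < lam N y -> (forall n, (n <= N)%N -> (t < lam n y) = (t' < lam n z)) ->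
  first_above y t = first_above z t'.
Proof.
move=> Xy Xz t1 t'1 lN e.
have [ly miny] := first_aboveP Xy t1; have [lz minz] := first_aboveP Xz t'1.
have yN : (first_above y t <= N)%N by apply: miny; exact: lt_trans lN.
have zy : (first_above z t' <= first_above y t)%N by apply: minz; rewrite -e.
apply/eqP; rewrite eqn_leq zy andbT; apply: miny.
by rewrite e// (leq_trans zy).
Qed.

(** For t uniformly distributed, [sel y t] is a random representative of y: a
    point of X represents itself; a point y outside X is represented by anchors
    in X, except that with probability delta y / 2 it is represented by its own
    copy, which keeps the information about y that anchors lose. *)
Definition sel y t : X + Y :=
  if pselect (X y) is left Xy then inl (SigSub (mem_set Xy))
  else if t < delta y / 2 then inr y else inl (alpha (first_above y t) y).

Lemma sel_in (x : X) t : sel (set_val x) t = inl x.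
Proof.
rewrite /sel; case: pselect => [Xx|[]]; last exact: set_valP.
by congr inl; exact: set_val_inj.
Qed.

Lemma sel_out y t : ~ X y -> sel y t =
  if t < delta y / 2 then inr y else inl (alpha (first_above y t) y).
Proof. by rewrite /sel; case: pselect. Qed.

Lemma sel_breakpoints y N (ns : seq nat) : ~ X y -> 1 < lam N y ->
  (forall n, (n <= N)%N -> 0 < lam n y -> n \in ns) ->
  breakpoints (delta y / 2 :: [seq lam n y | n <- ns]) (sel y).
Proof.
move=> Xy lN nsP t t' t0 tt' t1 h; rewrite !sel_out//.
have -> : (t < delta y / 2) = (t' < delta y / 2).
  have := h (delta y / 2); rewrite mem_head => /(_ isT); rewrite negb_and -leNgt -ltNge.
  case: (ltP t (delta y / 2)) => //= h1 _.
  by rewrite ltNge (le_trans h1 tt').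
rewrite (@first_above_eq N y t y t')// => [|n nN].
  exact: le_lt_trans t1.
case: (ltP t (lam n y)) => h1; last by rewrite ltNge (le_trans h1 tt').
have ln : lam n y \in delta y / 2 :: [seq lam n y | n <- ns].
  by rewrite inE map_f ?orbT// nsP//; exact: le_lt_trans h1.
by have := h _ ln; rewrite h1/= -ltNge => ->.
Qed.

Lemma sel_step y : step (sel y).
Proof.
have [Xy|Xy] := pselect (X y).
  exists [::] => t t' *; rewrite (_ : y = set_val (SigSub (mem_set Xy))) ?sel_in//.
have [N lN] := anchored_cover anch Xy; eexists.
by apply: (sel_breakpoints (ns := iota 0 N.+1) Xy lN) => n nN _; rewrite mem_iota.
Qed.

(** When p is a pseudometric, this extends it to the copies of the points of Y:
    on the copies it is a multiple of d, and every copy has the same distance to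
    x, the average of the distances from x to a and to b. All values are convex
    combinations of values of p, whence the terms in p (a, a), which vanish for
    pseudometrics but make constants and bounds pass to the extension. *)
Definition psum (p : X * X -> R) (uv : (X + Y) * (X + Y)) : R :=
  match uv with
  | (inl x, inl x') => p (x, x')
  | (inl x, inr _) => (p (x, a) + p (x, b)) / 2
  | (inr _, inl x) => (p (a, x) + p (b, x)) / 2
  | (inr y, inr y') =>
      d (y, y') * ((p (a, b) + p (b, a)) / 2) + (1 - d (y, y')) * p (a, a)
  end.

Lemma psum_linear k p q uv : psum (k *: p + q) uv = k * psum p uv + psum q uv.
Proof.
have E z : (k *: p + q) z = k * p z + q z by [].
by move: uv => [[x|y] [x'|y']] /=; rewrite !E; set f := LHS; rewrite /f; field.
Qed.

Lemma psum_cst c uv : psum (cst c) uv = c.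
Proof. by move: uv => [[x|y] [x'|y']] /=; rewrite /cst//; field. Qed.

Lemma psum_bound p (S : set X) (M : R) u v : S a -> S b ->
  (forall x x', S x -> S x' -> `|p (x, x')| <= M) ->
  (forall x, u = inl x -> S x) -> (forall x, v = inl x -> S x) ->
  `|psum p (u, v)| <= M.
Proof.
move=> Sa Sb pM; have pM' x x' : S x -> S x' -> - M <= p (x, x') <= M.
  by move=> ? ?; rewrite -ler_norml pM.
case: u v => [x|y] [x'|y'] /= uS vS; rewrite ler_norml.
- by apply: pM'; [exact: uS|exact: vS].
- have /andP[? ?] := pM' x a (uS _ erefl) Sa.
  by have /andP[? ?] := pM' x b (uS _ erefl) Sb; apply/andP; split; lra.
- have /andP[? ?] := pM' a x' Sa (vS _ erefl).
  by have /andP[? ?] := pM' b x' Sb (vS _ erefl); apply/andP; split; lra.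
- have /andP[? ?] := pM' a b Sa Sb; have /andP[? ?] := pM' b a Sb Sa.
  have /andP[? ?] := pM' a a Sa Sa; have := d1 (y, y').
  have := pseudometric_ge0 dm y y'; set D := d _ => D0 D1.
  by apply/andP; split; nra.
Qed.

Lemma psum_ge0 p uv : (forall z, 0 <= p z) -> 0 <= psum p uv.
Proof.
move=> p0; case: uv => [[x|y] [x'|y']] /=.
- exact: p0.
- by have := p0 (x, a); have := p0 (x, b); lra.
- by have := p0 (a, x'); have := p0 (b, x'); lra.
- have := p0 (a, b); have := p0 (b, a); have := p0 (a, a); have := d1 (y, y').
  by have := pseudometric_ge0 dm y y'; nra.
Qed.

Lemma psum_pseudometric p : is_pseudometric p -> is_pseudometric (psum p).
Proof.
move=> pm; have p0 := pseudometric_ge0 pm; have pxx := pseudometric_refl pm.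
have ps := pseudometric_sym pm; have pt := pseudometric_triangle pm.
have d0 := pseudometric_ge0 dm; have ds := pseudometric_sym dm.
split.
- by move=> u v; apply: psum_ge0 => -[x x'].
- move=> [x|y] /=; first exact: pxx.
  by rewrite (pseudometric_refl dm) pxx mul0r mulr0 add0r.
- by move=> [x|y] [x'|y'] /=; rewrite ?(ps a) ?(ps b) ?(ds y) ?[p (b, _)]ps.
- have := p0 a b => P0; have := ps b a => Ps; have Pa := pxx a.
  move=> [x'|y'] [x|y] [x''|y''] /=; rewrite ?Ps ?Pa ?mulr0 ?addr0.
  + exact: pt.
  + by have := pt x' x a; have := pt x' x b; lra.
  + by have := pt x' a x''; have := pt x' b x''; lra.
  + have := pt x' a b; have := d1 (y, y''); rewrite (ps x' a) (ps x' b).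
    by have := d0 y y''; have := p0 a b; nra.
  + by have := pt a x x''; have := pt b x x''; lra.
  + have := d0 y' y''; have := d1 (y', y''); have := p0 a b; nra.
  + have := d0 y y'; have := d1 (y, y'); have := p0 a b; nra.
  + have := pseudometric_triangle dm y' y y''; have := p0 a b; nra.
Qed.

(** The two points are represented at the same level t: the axioms of a
    pseudometric hold for the integrand at each t, hence for the mean. *)
Definition extend (p : X * X -> R) (z : Y * Y) : R :=
  mean (fun t => psum p (sel z.1 t, sel z.2 t)).

Lemma psum_step p y z : step (fun t => psum p (sel y t, sel z t)).
Proof.
exact: (step_comp2 (fun u v => psum p (u, v)) (sel_step y) (sel_step z)).
Qed.

Lemma extend_linear k p q : extend (k *: p + q) = k *: extend p + extend q.
Proof.
apply/funext => -[y z].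
change (extend (k *: p + q) (y, z) = k * extend p (y, z) + extend q (y, z)).
have sp := psum_step p y z; have sq := psum_step q y z.
rewrite /extend -meanZ// -meanD//; last exact: (step_comp (fun x => k * x) sp).
by apply: eq_mean => t _; rewrite psum_linear.
Qed.

Lemma extend_extends p (x x' : X) : extend p (set_val x, set_val x') = p (x, x').
Proof.
rewrite /extend -[RHS](mean_cst (p (x, x'))); apply: eq_mean => t _ /=.
by rewrite !sel_in.
Qed.

Lemma extend_cst c : extend (cst c) = cst c.
Proof.
apply/funext => z; rewrite /extend -[RHS](mean_cst c).
by apply: eq_mean => t _; exact: psum_cst.
Qed.

Lemma extend_ge0 p z : (forall z, 0 <= p z) -> 0 <= extend p z.
Proof. by move=> p0; apply: mean_ge0 => t _; exact: psum_ge0. Qed.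

(** The value at (y, z) is an average of values of p at a, b and the anchors of
    y and z. All three continuity properties of the operator come from this. *)
Lemma extend_bound p (S : set X) (M : R) y z : S a -> S b ->
  (forall x x', S x -> S x' -> `|p (x, x')| <= M) ->
  (forall t x, 0 <= t < 1 -> sel y t = inl x -> S x) ->
  (forall t x, 0 <= t < 1 -> sel z t = inl x -> S x) ->
  `|extend p (y, z)| <= M.
Proof.
move=> Sa Sb pM yS zS; apply: mean_norm_le => [|t ht]; first exact: psum_step.
apply: (psum_bound Sa Sb pM) => x; [exact: yS|exact: zS].
Qed.

Lemma extend_pseudometric p : is_pseudometric p -> is_pseudometric (extend p).
Proof.
move=> /psum_pseudometric em; split.
- move=> y z; apply: mean_ge0 => t _; exact: pseudometric_ge0.
- move=> y; rewrite /extend -[RHS](mean_cst 0); apply: eq_mean => t _.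
  exact: (pseudometric_refl em).
- by move=> y z; apply: eq_mean => t _; exact: (pseudometric_sym em).
- move=> y x z; rewrite /extend -meanD; [|exact: psum_step..].
  apply: le_mean; [exact: psum_step| |] => [|t _].
    by apply: (step_comp2 (fun x y => x + y)); exact: psum_step.
  exact: (pseudometric_triangle em).
Qed.


Lemma sel_near y t x : 0 <= t < 1 -> sel y t = inl x -> d (y, set_val x) <= 6 * delta y.
Proof.
move=> /andP[t0 t1]; have [Xy|Xy] := pselect (X y).
  rewrite (_ : y = set_val (SigSub (mem_set Xy))) ?sel_in// => -[<-].
  by rewrite (pseudometric_refl dm) mulr_ge0// dist_ge0.
rewrite sel_out//; case: ifP => // _ [<-]; apply: (anchored_near anch) => //.
by have [lt_t _] := first_aboveP Xy t1; exact: le_lt_trans lt_t.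
Qed.

Lemma sel_inl y t : delta y / 2 <= t -> exists x, sel y t = inl x.
Proof.
move=> ht; have [Xy|Xy] := pselect (X y).
  by exists (SigSub (mem_set Xy)); exact: (sel_in (SigSub (mem_set Xy))).
by rewrite sel_out// ltNge ht; eexists.
Qed.

Section PseudometricBounds.
Variable p : X * X -> R.
Hypothesis pm : is_pseudometric p.
Implicit Types y z : Y.

Let em := psum_pseudometric pm.
Let P := p (a, b).
Let P0 : 0 <= P. Proof. exact: (pseudometric_ge0 pm). Qed.

(** Each lower bound below comes from an interval of levels on which the kinds of
    both representatives are known; elsewhere the integrand is non-negative. *)
Lemma extend_ge_itv y z (s r c : R) : 0 <= s -> s <= r -> r <= 1 ->
  (forall t, s <= t < r -> c <= psum p (sel y t, sel z t)) ->
  (r - s) * c <= extend p (y, z).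
Proof.
move=> s0 sr r1 ec; rewrite -mean_itv// mulrC -meanZ; last exact: step_itvr.
apply: le_mean; [|exact: psum_step|].
  by apply: (step_comp (fun x => c * x)); exact: step_itvr.
move=> t _; have [/ec|_] := boolP (s <= t < r); first by rewrite mulr1.
by rewrite mulr0; exact: (pseudometric_ge0 em).
Qed.

(** Below the level m / 2 both points are represented by their copies. *)
Lemma extend_ge_copies y z m : m <= delta y -> m <= delta z ->
  m / 2 * (d (y, z) * P) <= extend p (y, z).
Proof.
move=> my mz; have [m0|m0] := leP m 0.
  apply: (@le_trans _ _ 0); last exact: (pseudometric_ge0 (extend_pseudometric pm)).
  rewrite mulr_le0_ge0 ?mulr_ge0 ?(pseudometric_ge0 dm)//; lra.
have out w : m <= delta w -> ~ X w.
  by move=> mw Xw; move: mw; rewrite dist0// leNgt m0.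
have m1 : m <= 1 by rewrite (le_trans my)// dist_le1.
rewrite -[m / 2]subr0; apply: extend_ge_itv; [by []|lra|lra|] => t /andP[t0 tm].
rewrite !sel_out; [|exact: out..].
rewrite !ifT; [|lra|lra].
rewrite /psum (pseudometric_refl pm) mulr0 addr0 (pseudometric_sym pm b).
by rewrite -/P (_ : (P + P) / 2 = P)//; field.
Qed.

(** At the levels between delta y / 2 and delta z / 2 one point is represented by
    its copy and the other one by an anchor, and a copy has distance at least
    p (a, b) / 2 to every point of X. *)
Lemma extend_ge_diff y z : `|delta y - delta z| * P <= 4 * extend p (y, z).
Proof.
wlog yz : y z / delta y <= delta z.
  move=> H; case: (leP (delta y) (delta z)) => [|/ltW] yz; first exact: H.
  by rewrite distrC (pseudometric_sym (extend_pseudometric pm)); exact: H.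
rewrite distrC ger0_norm ?subr_ge0//.
have [zy|zy] := leP (delta z) (delta y).
  rewrite (_ : delta z = delta y) ?subrr ?mul0r ?mulr_ge0//.
    exact: (pseudometric_ge0 (extend_pseudometric pm)).
  by apply/eqP; rewrite eq_le zy.
have Xz : ~ X z.
  by move=> Xz; move: zy; rewrite (dist0 dm Xz) ltNge dist_ge0.
have d0 := dist_ge0 dm X y; have z1 := dist_le1 dm X z.
have : (delta z / 2 - delta y / 2) * (P / 2) <= extend p (y, z); last by lra.
apply: extend_ge_itv; [lra..|] => t /andP[ht tz].
have [x ->] := sel_inl ht; rewrite sel_out// ifT//= ler_pM2r// /P.
by rewrite (pseudometric_sym pm x a); exact: (pseudometric_triangle pm).
Qed.

(** Since delta is at most 1, all representatives at levels from 1/2 on are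
    anchors. *)
Lemma extend_anchors y z c : 0 < c -> extend p (y, z) < c / 2 ->
  exists x x', [/\ p (x, x') < c, exists2 t, 0 <= t < 1 & sel y t = inl x
    & exists2 t, 0 <= t < 1 & sel z t = inl x'].
Proof.
move=> c0 Tc; apply: contrapT => H; move: Tc; apply/negP; rewrite -leNgt.
rewrite (_ : c / 2 = (1 - 1 / 2) * c); last by lra.
apply: extend_ge_itv; [lra..|] => t /andP[ht t1].
have y1 := dist_le1 dm X y; have z1 := dist_le1 dm X z.
have [|x yx] := @sel_inl y t; first lra.
have [|x' zx'] := @sel_inl z t; first lra.
rewrite yx zx' /= leNgt; apply/negP => pc; apply: H; exists x, x'.
by split => //; exists t => //; apply/andP; split => //; lra.
Qed.

Hypothesis ab : 0 < P.

(** By [extend_ge_diff] a small value forces nearly equal distances to X, so that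
    both points keep their copies on a set of levels of length at least h / 4;
    there [extend_ge_copies] controls d (y, z). *)
Lemma extend_small_off y z h e : 0 < e -> 0 < h -> h <= delta y \/ h <= delta z ->
  extend p (y, z) < P * h / 8 -> extend p (y, z) < P * h * e / 4 -> d (y, z) < e.
Proof.
move=> e0 h0 hyz T1 T2; have := extend_ge_diff y z => D.
have : `|delta y - delta z| < h / 2.
  by rewrite -(ltr_pM2r ab); apply: le_lt_trans D _; lra.
rewrite ltr_norml => /andP[d1' d2'].
have : h / 2 / 2 * (d (y, z) * P) <= extend p (y, z).
  by apply: extend_ge_copies; case: hyz => ?; lra.
move=> H; have hP : 0 < h * P by exact: mulr_gt0.
by rewrite -(ltr_pM2r hP); lra.
Qed.

(** Near X the points are close to their anchors, and [extend_anchors] finds anchors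
    that are close to each other. The constant 24 accounts for the two
    distances of at most 6 delta from a point to its anchor. *)
Lemma extend_small_near y z r e : 0 < e -> 0 < r ->
  (forall x x', (exists2 t, 0 <= t < 1 & sel y t = inl x) -> p (x, x') < r ->
     d (set_val x, set_val x') < e / 2) ->
  delta y < e / 24 -> delta z < e / 24 ->
  extend p (y, z) < r / 2 -> d (y, z) < e.
Proof.
move=> e0 r0 pr dy dz /(extend_anchors r0)[x [x' [pxx' yx [t ht zx']]]].
have := pr _ _ yx pxx'; have [t' ht' yx'] := yx.
have := sel_near ht zx'; have := sel_near ht' yx'.
have := pseudometric_triangle dm (set_val x) y z.
have := pseudometric_triangle dm (set_val x') (set_val x) z.
by rewrite (pseudometric_sym dm (set_val x') z); lra.
Qed.

Lemma extend_dominating :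
  (forall (x : X) e, 0 < e -> exists2 r, 0 < r &
     forall x' : X, p (x, x') < r -> d (set_val x, set_val x') < e) ->
  forall y e, 0 < e -> exists2 r, 0 < r &
     forall z, extend p (y, z) < r -> d (y, z) < e.
Proof.
move=> pdom y e e0.
have [Xy|Xy] := pselect (X y); last first.
  have dy := Xpos Xy; exists (Num.min (P * delta y / 8) (P * delta y * e / 4)).
    by rewrite lt_min !divr_gt0 ?mulr_gt0.
  move=> z; rewrite lt_min => /andP[? ?].
  by apply: (extend_small_off (h := delta y)) => //; left.
pose x : X := SigSub (mem_set Xy); have yx : y = set_val x by [].
have [//|r r0 pr] := pdom x (e / 2); first by rewrite divr_gt0.
pose h := e / 24; have h0 : 0 < h by rewrite divr_gt0.
exists (Num.min (r / 2) (Num.min (P * h / 8) (P * h * e / 4))).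
  by rewrite !lt_min !divr_gt0 ?mulr_gt0.
move=> z; rewrite !lt_min => /and3P[T1 T2 T3].
have [dz|dz] := ltP (delta z) h; last by apply: (extend_small_off (h := h)) => //; right.
apply: (extend_small_near e0 r0) => //.
  by move=> u x' [t _]; rewrite yx sel_in => -[<-]; exact: pr.
by rewrite (dist0 dm Xy).
Qed.

Lemma extend_uniformly_dominating :
  (forall e, 0 < e -> exists2 r, 0 < r &
     forall x x' : X, p (x, x') < r -> d (set_val x, set_val x') < e) ->
  forall e, 0 < e -> exists2 r, 0 < r &
     forall y z, extend p (y, z) < r -> d (y, z) < e.
Proof.
move=> pdom e e0; have [//|r r0 pr] := pdom (e / 2); first by rewrite divr_gt0.
pose h := e / 24; have h0 : 0 < h by rewrite divr_gt0.
exists (Num.min (r / 2) (Num.min (P * h / 8) (P * h * e / 4))).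
  by rewrite !lt_min !divr_gt0 ?mulr_gt0.
move=> y z; rewrite !lt_min => /and3P[T1 T2 T3].
have [dy|dy] := ltP (delta y) h; last by apply: (extend_small_off (h := h)) => //; left.
have [dz|dz] := ltP (delta z) h; last by apply: (extend_small_off (h := h)) => //; right.
by apply: (extend_small_near e0 r0) => // u x' _; exact: pr.
Qed.

Lemma extend_separated : (forall x x', p (x, x') = 0 -> x = x') ->
  (forall y z, d (y, z) = 0 -> y = z) -> forall y z, extend p (y, z) = 0 -> y = z.
Proof.
move=> psep dsep y z T0.
have [[Xy Xz]|XX] := pselect (X y /\ X z).
  pose x : X := SigSub (mem_set Xy); pose x' : X := SigSub (mem_set Xz).
  change (set_val x = set_val x'); congr set_val; apply: psep.
  by rewrite -[LHS](extend_extends p).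
have [h h0 hyz] : exists2 h, 0 < h & h <= delta y \/ h <= delta z.
  have [Xy|Xy] := pselect (X y); last by exists (delta y); [exact: Xpos|left].
  exists (delta z); last by right.
  by apply: Xpos => Xz; apply: XX.
apply: dsep; apply/eqP; rewrite eq_le (pseudometric_ge0 dm) andbT.
apply/ler_addgt0Pl => e e0; rewrite addr0; apply/ltW/(extend_small_off e0 h0 hyz).
  by rewrite T0 divr_gt0 ?mulr_gt0.
by rewrite T0 divr_gt0 ?mulr_gt0.
Qed.

End PseudometricBounds.

Definition between (x y t : R) : bool := (Num.min x y <= t < Num.max x y)%R.

Lemma mean_between x y : mean (fun t => (between x y t)%:R) <= `|y - x|.
Proof.
apply: (le_trans (mean_itv_le _)); first by rewrite ge_min !le_max !lexx.
by case: (leP x y) => h; [rewrite ger0_norm ?subr_ge0|rewrite distrC gtr0_norm ?subr_gt0].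
Qed.

Lemma lt_between x y t : ~~ between x y t -> (t < x) = (t < y).
Proof.
rewrite /between ge_min lt_max negb_and !negb_or -!ltNge -!leNgt.
by case: (ltP t x) => /=; case: (ltP t y) => /= ? ? //; rewrite ?andbF ?andbT //= ; lra.
Qed.

Lemma pos_forall (I : eqType) (s : seq I) (Q : I -> R -> Prop) :
  (forall i r r', 0 < r -> r <= r' -> Q i r' -> Q i r) ->
  (forall i, i \in s -> exists2 r, 0 < r & Q i r) ->
  exists2 r, 0 < r & forall i, i \in s -> Q i r.
Proof.
move=> Qmono; elim: s => [|i s IHs] sQ; first by exists 1.
have [r r0 Qr] := IHs (fun j js => sQ _ (mem_behead (s := i :: s) js)).
have [r' r'0 Qr'] := sQ i (mem_head _ _).
have m0 : 0 < Num.min r r' by rewrite lt_min r0.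
exists (Num.min r r') => // j; rewrite inE => /orP[/eqP ->|js].
  by apply: Qmono Qr' => //; rewrite ge_min lexx orbT.
by apply: Qmono (Qr _ js) => //; rewrite ge_min lexx.
Qed.

Definition dsum (u v : X + Y) : R :=
  match u, v with
  | inl x, inl x' => d (set_val x, set_val x')
  | inr y, inr y' => d (y, y')
  | _, _ => 1
  end.

Lemma dsum_ge0 u v : 0 <= dsum u v.
Proof. by case: u v => [x|y] [x'|y'] //=; exact: (pseudometric_ge0 dm). Qed.

Lemma outside_near y : ~ X y -> forall z, d (y, z) < delta y -> ~ X z.
Proof. by move=> Xy z yz Xz; move: (dist_le dm y Xz); rewrite leNgt yz. Qed.

(** An index beating all levels at y does so near y, by continuity; hence only
    finitely many indices are in use near y, and by [anchored_local] each of them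
    has a single anchor there. *)
Lemma local_selection y : ~ X y -> exists N, 1 < lam N y /\
  exists2 s, 0 < s & forall z, d (y, z) < s ->
    [/\ ~ X z, 1 < lam N z & forall n z', (n <= N)%N -> d (y, z') < s ->
        0 < lam n z -> 0 < lam n z' -> alpha n z = alpha n z'].
Proof.
move=> Xy; have [N lN] := anchored_cover anch Xy; exists N; split => //.
have [|r1 r10 hr1] := anchored_continuous anch N Xy (e := lam N y - 1).
  by rewrite subr_gt0.
have [||r2 r20 hr2] := @pos_forall nat (iota 0 N.+1)
    (fun n r => forall z z', d (y, z) < r -> d (y, z') < r ->
      0 < lam n z -> 0 < lam n z' -> alpha n z = alpha n z').
- move=> n r r' r0 rr' h z z' yz yz'; apply: h; exact: lt_le_trans rr'.
- by move=> n _; exact: (anchored_local anch n Xy).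
exists (Num.min (delta y) (Num.min r1 r2)); first by rewrite !lt_min Xpos ?r10.
move=> z; rewrite !lt_min => /and3P[zd zr1 zr2]; split.
- exact: outside_near zd.
- by have := hr1 _ zr1; rewrite ltr_norml => /andP[h _]; lra.
- move=> n z' nN; rewrite !lt_min => /and3P[_ _ z'r2]; apply: hr2 => //.
  by rewrite mem_iota.
Qed.

Lemma local_anchors y : ~ X y -> exists (F : seq X), exists2 s, 0 < s &
  forall z, d (y, z) < s -> ~ X z /\
    forall t x, 0 <= t < 1 -> sel z t = inl x -> x \in F.
Proof.
move=> Xy; have [N [lN [s s0 hs]]] := local_selection Xy.
have /choice[v hv] n : exists x : X, forall z, (n <= N)%N -> d (y, z) < s ->
    0 < lam n z -> alpha n z = x.
  have [[z [yz lz]]|H] := pselect (exists z, d (y, z) < s /\ 0 < lam n z).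
    exists (alpha n z) => z' nN yz' lz'; have [_ _ h] := hs _ yz'; exact: h.
  by exists a => z _ yz lz; exfalso; apply: H; exists z.
exists [seq v n | n <- iota 0 N.+1], s => // z yz; have [Xz lNz _] := hs _ yz.
split => // t x /andP[t0 t1]; rewrite sel_out//; case: ifP => // _ [<-].
have [lt_t min_t] := first_aboveP Xz t1.
have nN : (first_above z t <= N)%N by apply: min_t; exact: lt_trans lNz.
rewrite (hv _ _ nN yz) ?map_f ?mem_iota//.
exact: le_lt_trans lt_t.
Qed.

(** Near a point of X infinitely many anchors may be in use, but they are all
    close to that point; this is why the values are only approximated here. *)
Lemma sel_finite_near y : exists F : seq (X + Y),
  (forall t, 0 <= t < 1 -> sel y t \in F) /\
  forall r, 0 < r -> exists2 s, 0 < s & forall z, d (y, z) < s ->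
    forall t, 0 <= t < 1 -> exists2 u, u \in F & dsum u (sel z t) < r.
Proof.
have [Xy|Xy] := pselect (X y).
  pose x : X := SigSub (mem_set Xy); have yx : y = set_val x by [].
  exists [:: inl x; inr y]; split => [t _|r r0].
    by rewrite yx sel_in mem_head.
  exists (r / 7) => [|z yz t ht]; first by rewrite divr_gt0.
  case E : (sel z t) => [x'|y'].
    exists (inl x); rewrite ?mem_head//= -yx.
    have := sel_near ht E; have := pseudometric_triangle dm z y (set_val x').
    have := dist_le dm z Xy; rewrite (pseudometric_sym dm z y); lra.
  exists (inr y); rewrite ?inE ?eqxx ?orbT//=.
  have -> : y' = z; last by lra.
  move: E; rewrite /sel; case: pselect => // _.
  by case: ifP => // _ [].
have [F [s s0 hs]] := local_anchors Xy.
have yy : d (y, y) < s by rewrite (pseudometric_refl dm).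
exists (inr y :: [seq inl x | x <- F]); split.
  move=> t ht; have [_ hF] := hs _ yy; case E : (sel y t) => [x'|y'].
    by rewrite inE map_f// (hF t).
  by move: E; rewrite sel_out//; case: ifP => // _ [->]; rewrite mem_head.
move=> r r0; exists (Num.min s r); first by rewrite lt_min s0.
move=> z; rewrite lt_min => /andP[zs zr] t ht; have [Xz hF] := hs _ zs.
case E : (sel z t) => [x'|y'].
  exists (inl x'); last by rewrite /= (pseudometric_refl dm).
  by rewrite inE map_f// (hF t).
exists (inr y); first exact: mem_head.
by move: E; rewrite sel_out//; case: ifP => // _ [<-].
Qed.

Lemma step_dsum y z : step (fun t => dsum (sel y t) (sel z t)).
Proof. exact: (step_comp2 dsum (sel_step y) (sel_step z)). Qed.

Lemma step_between x y : step (fun t => (between x y t)%:R : R).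
Proof. exact: step_itvr. Qed.

(** Continuity in probability of the selection. Outside X, two selections
    can differ at the level t only if t lies between the heights at which the
    copies are dropped or between lam n y and lam n z for one of the finitely
    many indices n in use. Near a point of X, copies occupy few levels and the
    anchors are close to that point. *)
Lemma sel_continuous y e : 0 < e -> exists2 s, 0 < s & forall z, d (y, z) < s ->
  mean (fun t => dsum (sel y t) (sel z t)) <= e.
Proof.
move=> e0; have [Xy|Xy] := pselect (X y).
  pose x : X := SigSub (mem_set Xy); have yx : y = set_val x by [].
  exists (e / 8) => [|z yz]; first by rewrite divr_gt0.
  have dz := dist_le dm z Xy; rewrite (pseudometric_sym dm z y) in dz.
  apply: (@le_trans _ _
    (mean (fun t => (between 0 (delta z / 2) t)%:R + 7 * d (y, z)))).
    apply: le_mean; first exact: step_dsum.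
      apply: (step_comp2 (fun x y => x + y)); first exact: step_between.
      exact: step_cst.
    move=> t ht; rewrite {1}yx sel_in; case E : (sel z t) => [x'|y'].
      rewrite /= -yx ler_wpDl//.
      have := sel_near ht E; have := pseudometric_triangle dm z y (set_val x').
      lra.
    rewrite ler_wpDr ?mulr_ge0 ?(pseudometric_ge0 dm)//=.
    rewrite (_ : between _ _ _ = true)//.
    have tz : t < delta z / 2.
      move: E; rewrite /sel; case: pselect => // _.
      by case: ifP.
    by rewrite /between ge_min lt_max tz orbT; case/andP: ht => ->.
  rewrite meanD ?mean_cst; [|exact: step_between|exact: step_cst].
  have := mean_between 0 (delta z / 2); rewrite subr0 ger0_norm.
    lra.
  by rewrite divr_ge0 ?dist_ge0.
have [N [lN [s s0 hs]]] := local_selection Xy.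
have yy : d (y, y) < s by rewrite (pseudometric_refl dm).
(* N + 1 indices, the heights and d (y, z) contribute at most w each *)
pose w := e / N.+4%:R; have w0 : 0 < w by rewrite divr_gt0.
have [||r r0 hr] := @pos_forall nat (iota 0 N.+1)
    (fun n r => forall z, d (y, z) < r -> `|lam n z - lam n y| < w).
- by move=> n r r' r0 rr' h z yz; apply: h; exact: lt_le_trans rr'.
- by move=> n _; exact: (anchored_continuous anch n Xy).
exists (Num.min s (Num.min r w)); first by rewrite !lt_min s0 r0.
move=> z; rewrite !lt_min => /and3P[zs zr zw].
have [Xz lNz _] := hs _ zs; have [_ _ hy] := hs _ yy.
pose S t := \sum_(n <- iota 0 N.+1) (between (lam n y) (lam n z) t)%:R : R.
have [sS meanS] := mean_sum (iota 0 N.+1)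
  (fun n => step_between (lam n y) (lam n z)).
pose D t := (between (delta y / 2) (delta z / 2) t)%:R : R.
have sD : step D by exact: step_between.
apply: (@le_trans _ _ (mean (fun t => S t + (D t + d (y, z))))).
  apply: le_mean; first exact: step_dsum.
    apply: (step_comp2 (fun x y => x + y)) => //.
    by apply: (step_comp2 (fun x y => x + y)) => //; exact: step_cst.
  move=> t /andP[t0 t1].
  have S0 : 0 <= S t by apply: sumr_ge0 => n _; case: between.
  have dyz := pseudometric_ge0 dm y z.
  have le1 u v : dsum u v <= 1 by case: u v => [?|?] [?|?] /=.
  rewrite /D; have [_|bD] := boolP (between _ _ t).
    by apply: le_trans (le1 _ _) _; rewrite /=; lra.
  have [/hasP[n nN bn]|] := boolP (has (fun n => between (lam n y) (lam n z) t) (iota 0 N.+1)).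
    apply: le_trans (le1 _ _) _; rewrite add0r.
    suff : 1 <= S t by lra.
    rewrite /S (big_rem n)//= bn lerDl.
    by apply: sumr_ge0 => m _; case: between.
  move=> /hasPn nb; rewrite add0r ler_wpDl//.
  rewrite !sel_out// (lt_between bD); case: ifP => // _.
  have eqn : first_above y t = first_above z t.
    apply: (first_above_eq Xy Xz t1 t1 lN) => n nN.
    by apply: lt_between; apply: nb; rewrite mem_iota.
  have [ly miny] := first_aboveP Xy t1; have [lz _] := first_aboveP Xz t1.
  rewrite -eqn in lz *.
  rewrite /= (hy _ z) ?(pseudometric_refl dm)//.
  - by apply: miny; exact: lt_trans lN.
  - exact: le_lt_trans ly.
  - exact: le_lt_trans lz.
rewrite meanD//; last by apply: (step_comp2 (fun x y => x + y)) => //; exact: step_cst.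
rewrite meanD//; last exact: step_cst.
rewrite mean_cst meanS.
have hS : \sum_(n <- iota 0 N.+1) mean (fun t => (between (lam n y) (lam n z) t)%:R)
    <= \sum_(n <- iota 0 N.+1) w.
  rewrite !big_seq; apply: ler_sum => n nN; apply: le_trans (mean_between _ _) _.
  by apply/ltW/hr.
have hD : mean D <= w.
  apply: le_trans (mean_between _ _) _; rewrite -mulrBl normrM.
  rewrite [`|_^-1|]gtr0_norm ?invr_gt0//.
  have := dist_lip_norm dm X z y; rewrite (pseudometric_sym dm z y).
  have := normr_ge0 (delta z - delta y); lra.
have sw : \sum_(n <- iota 0 N.+1) w = w * N.+1%:R.
  by rewrite big_const_seq count_predT size_iota iter_addr_0 mulr_natr.
have ew : e = w * N.+4%:R by rewrite /w divfK.
rewrite ew; move: hS; rewrite sw.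
rewrite -!(natr1 N.+3) -!(natr1 N.+2) -!(natr1 N.+1) !mulrDr !mulr1; lra.
Qed.

Lemma psum_continuous p u v e :
  (forall x x' : X, forall e, 0 < e -> exists2 r, 0 < r & forall w w' : X,
     d (set_val x, set_val w) < r -> d (set_val x', set_val w') < r ->
     `|p (w, w') - p (x, x')| < e) ->
  0 < e -> exists2 r, 0 < r & forall u' v', dsum u u' < r -> dsum v v' < r ->
    `|psum p (u', v') - psum p (u, v)| < e.
Proof.
move=> pc e0.
have daa x : d (set_val x, set_val x) = 0 by exact: (pseudometric_refl dm).
have shrink (r : R) : 0 < r -> 0 < Num.min r 1 by move=> r0; rewrite lt_min r0 ltr01.
case: u v => [x|y] [x'|y'].
- have [r r0 pr] := pc x x' _ e0; exists (Num.min r 1); first exact: shrink.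
  by move=> [w|?] [w'|?]; rewrite !lt_min ?ltxx ?andbF//= => /andP[? _] /andP[? _]; exact: pr.
- have [r r0 pr] := pc x a _ e0; have [r' r'0 pr'] := pc x b _ e0.
  exists (Num.min (Num.min r r') 1).
    by apply: shrink; rewrite lt_min r0.
  move=> [w|?] [?|w']; rewrite !lt_min /= ?ltxx ?andbF// => /andP[/andP[wr wr'] _] _.
  have := pr w a wr; rewrite daa => /(_ r0); have := pr' w b wr'; rewrite daa => /(_ r'0).
  rewrite !ltr_norml => /andP[? ?] /andP[? ?]; apply/andP; split; lra.
- have [r r0 pr] := pc a x' _ e0; have [r' r'0 pr'] := pc b x' _ e0.
  exists (Num.min (Num.min r r') 1).
    by apply: shrink; rewrite lt_min r0.
  move=> [?|w'] [w|?]; rewrite !lt_min /= ?ltxx ?andbF// => _ /andP[/andP[wr wr'] _].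
  have := pr a w; rewrite daa => /(_ r0 wr); have := pr' b w; rewrite daa => /(_ r'0 wr').
  rewrite !ltr_norml => /andP[? ?] /andP[? ?]; apply/andP; split; lra.
- pose k := (p (a, b) + p (b, a)) / 2 - p (a, a).
  pose r := e / (2 * (`|k| + 1)).
  have k0 : 0 < `|k| + 1 by rewrite ltr_wpDl.
  have r0 : 0 < r by rewrite divr_gt0// mulr_gt0.
  exists (Num.min r 1); first exact: shrink.
  move=> [?|w] [?|w']; rewrite !lt_min /= ?ltxx ?andbF// => /andP[wr _] /andP[wr' _].
  rewrite (_ : _ - _ = (d (w, w') - d (y, y')) * k); last by rewrite /k; ring.
  have := pseudometric_triangle dm y w w'; have := pseudometric_triangle dm y' y w'.
  have := pseudometric_triangle dm w y y'; have := pseudometric_triangle dm w' w y'.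
  rewrite (pseudometric_sym dm w y) (pseudometric_sym dm w' y') => h1 h2 h3 h4.
  have h : `|d (w, w') - d (y, y')| <= 2 * r.
    by rewrite ler_norml; apply/andP; split; lra.
  rewrite normrM; apply: (@le_lt_trans _ _ (2 * r * `|k|)).
    by rewrite ler_wpM2r.
  have -> : e = 2 * r * (`|k| + 1) by rewrite /r; field; rewrite gt_eqF.
  by rewrite ltr_pM2l ?mulr_gt0// ltrDl.
Qed.

(** Convergence in probability of the selections suffices, because near (y, z)
    the integrands are uniformly bounded, by [sel_finite_near]. *)
Lemma extend_continuous p :
  (forall x x' : X, forall e, 0 < e -> exists2 r, 0 < r & forall w w' : X,
     d (set_val x, set_val w) < r -> d (set_val x', set_val w') < r ->
     `|p (w, w') - p (x, x')| < e) ->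
  forall y z e, 0 < e -> exists2 s, 0 < s & forall y' z',
    d (y, y') < s -> d (z, z') < s -> `|extend p (y', z') - extend p (y, z)| < e.
Proof.
move=> pc y z e e0.
have [F [Fy hF]] := sel_finite_near y; have [G [Gz hG]] := sel_finite_near z.
have e4 : 0 < e / 4 by rewrite divr_gt0.
have [||r r0 hr] := @pos_forall _ (allpairs pair F G)
    (fun uv r => forall u' v', dsum uv.1 u' < r -> dsum uv.2 v' < r ->
      `|psum p (u', v') - psum p uv| < e / 4).
- by move=> uv r r' r0 rr' h u' v' h1 h2; apply: h; exact: lt_le_trans rr'.
- by move=> [u v] _; exact: psum_continuous.
(* bounds the integrand at all points near (y, z) *)
pose K := \sum_(uv <- allpairs pair F G) `|psum p uv| + e / 4.
have K0 : 0 < K by rewrite ltr_wpDl// sumr_ge0.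
have KFG u v : u \in F -> v \in G -> `|psum p (u, v)| + e / 4 <= K.
  move=> uF vG; rewrite lerD2r (big_rem (u, v))/=; last exact: allpairs_f.
  by rewrite lerDl sumr_ge0.
pose w := e / 4 * r / (4 * K).
have w0 : 0 < w by rewrite divr_gt0 ?mulr_gt0.
have [s1 s10 h1] := hF _ r0; have [s2 s20 h2] := hG _ r0.
have [s3 s30 h3] := sel_continuous y w0; have [s4 s40 h4] := sel_continuous z w0.
exists (Num.min (Num.min s1 s3) (Num.min s2 s4)).
  by rewrite !lt_min s10 s20 s30 s40.
move=> y' z'; rewrite !lt_min => /andP[/andP[y1 y3] _] /andP[_ /andP[z2 z4]].
pose k := 2 * K / r; have k0 : 0 <= k by rewrite divr_ge0 ?mulr_ge0 ?ltW.
have sy := step_dsum y y'; have sz := step_dsum z z'.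
have sp := psum_step p y z; have sp' := psum_step p y' z'.
have syz : step (fun t => dsum (sel y t) (sel y' t) + dsum (sel z t) (sel z' t)).
  exact: (step_comp2 (fun x y => x + y)).
have sk := step_comp (fun x => k * x) syz.
have sN : step (fun t => (-1) * psum p (sel y t, sel z t)).
  exact: (step_comp (fun x => (-1) * x)).
have sd := step_comp2 (fun x y => x + y) sp' sN.
have -> : extend p (y', z') - extend p (y, z) =
    mean (fun t => psum p (sel y' t, sel z' t) + (-1) * psum p (sel y t, sel z t)).
  by rewrite meanD// meanZ// mulN1r.
have le_dist t : 0 <= t < 1 ->
    `|psum p (sel y' t, sel z' t) + (-1) * psum p (sel y t, sel z t)| <=
    e / 4 + k * (dsum (sel y t) (sel y' t) + dsum (sel z t) (sel z' t)).
  move=> ht; rewrite mulN1r.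
  have Dy := dsum_ge0 (sel y t) (sel y' t); have Dz := dsum_ge0 (sel z t) (sel z' t).
  have FG u v : u \in F -> v \in G -> (u, v) \in allpairs pair F G by exact: allpairs_f.
  have bound : r <= dsum (sel y t) (sel y' t) + dsum (sel z t) (sel z' t) ->
      `|psum p (sel y' t, sel z' t) - psum p (sel y t, sel z t)| <=
      k * (dsum (sel y t) (sel y' t) + dsum (sel z t) (sel z' t)).
    move=> rD; apply: (@le_trans _ _ (K + K)); last first.
      by have -> : K + K = k * r; [rewrite /k; field; rewrite gt_eqF|exact: ler_wpM2l].
    have [u uF hu] := h1 _ y1 _ ht; have [v vG hv] := h2 _ z2 _ ht.
    have h := hr _ (FG _ _ uF vG) _ _ hu hv.
    have := KFG _ _ uF vG; have := KFG _ _ (Fy _ ht) (Gz _ ht).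
    have := ler_normB (psum p (sel y' t, sel z' t)) (psum p (sel y t, sel z t)).
    have := ler_normD (psum p (u, v)) (psum p (sel y' t, sel z' t) - psum p (u, v)).
    rewrite addrC subrK; lra.
  have [ly|ry] := ltP (dsum (sel y t) (sel y' t)) r; last first.
    by apply: (le_trans (bound _)); [lra|rewrite lerDr ltW].
  have [lz|rz] := ltP (dsum (sel z t) (sel z' t)) r; last first.
    by apply: (le_trans (bound _)); [lra|rewrite lerDr ltW].
  apply: (@le_trans _ _ (e / 4)); last by rewrite lerDl mulr_ge0// addr_ge0.
  exact/ltW/(hr _ (FG _ _ (Fy _ ht) (Gz _ ht))).
have sR : step (fun t => e / 4 +
    k * (dsum (sel y t) (sel y' t) + dsum (sel z t) (sel z' t))).
  exact: (step_comp (fun x => e / 4 + x)).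
apply: (@le_lt_trans _ _ (mean (fun t => e / 4 +
  k * (dsum (sel y t) (sel y' t) + dsum (sel z t) (sel z' t))))).
  apply: le_trans (norm_mean_le sd) _.
  by apply: le_mean le_dist => //; exact: (step_comp (fun x => `|x|)).
rewrite meanD ?mean_cst ?meanZ ?meanD//; last exact: step_cst.
apply: (@le_lt_trans _ _ (e / 4 + k * (w + w))).
  by rewrite lerD2l ler_wpM2l// lerD ?h3 ?h4.
have -> : k * (w + w) = e / 4 by rewrite /k /w; field; rewrite !gt_eqF.
lra.
Qed.

Section TotallyBounded.
Variable N : nat.
Hypothesis lamN : multiplicity_le X lam N.
Hypothesis dtb : totally_bounded_pseudometric d.

Lemma sel_few_breakpoints y : exists2 s : seq R, (size s <= N.+1)%N &
  breakpoints s (sel y).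
Proof.
have [Xy|Xy] := pselect (X y).
  exists [::] => // t t' *.
  by rewrite (_ : y = set_val (SigSub (mem_set Xy))) ?sel_in.
have [ns sns nsP] := lamN Xy; have [M lM] := anchored_cover anch Xy.
exists (delta y / 2 :: [seq lam n y | n <- ns]); first by rewrite /= size_map.
by apply: (sel_breakpoints Xy lM) => n _; exact: nsP.
Qed.

Lemma psum_totally_bounded p : totally_bounded_pseudometric p ->
  forall e, 0 < e -> exists s : seq (X + Y), forall u, exists2 c, c \in s &
    psum p (c, u) < e.
Proof.
move=> [pm ptb] e e0; have P0 := pseudometric_ge0 pm a b.
have [C finC hC] := ptb e e0.
have [|C' finC' hC'] := dtb.2 (e / (p (a, b) + 1)).
  by rewrite divr_gt0// ltr_wpDl.
move: finC finC' => /finite_seqP[s Cs] /finite_seqP[s' Cs'].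
exists ([seq inl x | x <- s] ++ [seq inr y | y <- s']) => -[x|y].
  have [c Cc dc] := hC x; exists (inl c) => //.
  by rewrite mem_cat map_f//; move: Cc; rewrite Cs.
have [c Cc dc] := hC' y; exists (inr c).
  by rewrite mem_cat orbC map_f//; move: Cc; rewrite Cs'.
rewrite /psum (pseudometric_refl pm) mulr0 addr0 (pseudometric_sym pm b).
rewrite (_ : (_ + _) / 2 = p (a, b)); last by field.
move: dc; rewrite ltr_pdivlMr ?ltr_wpDl//; apply: le_lt_trans.
by rewrite ler_wpM2l ?lerDl// (pseudometric_ge0 dm).
Qed.

(** Record, up to a small error, the values of [sel y] at the multiples of 1/Q;
    only finitely many records are possible. If y and z have the same record,
    then their representatives are close at all levels t except those that
    follow a breakpoint of [sel y] or [sel z] by less than 1/Q, and the uniform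
    bound on the number of breakpoints makes these levels few. *)
Lemma extend_totally_bounded p :
  totally_bounded_pseudometric p -> totally_bounded_pseudometric (extend p).
Proof.
move=> ptb; have pm := ptb.1; have em := psum_pseudometric pm.
have e0 := pseudometric_ge0 em; have es := pseudometric_sym em.
have et := pseudometric_triangle em.
split=> [|e e_gt0]; first exact: extend_pseudometric.
have [s1 hs1] := psum_totally_bounded ptb (@ltr01 R).
pose D := \sum_(uv <- allpairs pair s1 s1) psum p uv + 2.
have eD u v : psum p (u, v) <= D.
  have [c cs hc] := hs1 u; have [c' cs' hc'] := hs1 v.
  have : psum p (c, c') <= \sum_(uv <- allpairs pair s1 s1) psum p uv.
    rewrite (big_rem (c, c'))/=; last exact: allpairs_f.
    by rewrite lerDl sumr_ge0// => -[w w'] _; exact: e0.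
  have := et c u v; have := et c' c v; rewrite (es u c) /D; lra.
have D0 : 0 < D.
  by rewrite /D ltr_wpDl// sumr_ge0// => -[w w'] _; exact: e0.
have [|s hs] := @psum_totally_bounded p ptb (e / 6); first by rewrite divr_gt0.
pose cl u := find (fun c => psum p (c, u) < e / 6) s.
have clP u : (cl u < size s)%N.
  by rewrite -has_find; apply/hasP; have [c cs hc] := hs u; exists c.
have cl_eq u v : cl u = cl v -> psum p (u, v) < e / 3.
  move=> uv; have hu : has (fun c => psum p (c, u) < e / 6) s by rewrite has_find clP.
  have hv : has (fun c => psum p (c, v) < e / 6) s by rewrite has_find clP.
  have := nth_find (inl a) hu; have := nth_find (inl a) hv.
  rewrite -/(cl u) -/(cl v) uv; set c := nth _ _ _ => h1 h2.
  by have := et c u v; rewrite (es u c); lra.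
pose Q := (Num.truncn (D * (2 * N.+1)%:R / (e / 3))).+1.
have Q0 : 0 < Q%:R :> R by rewrite ltr0n.
have hQ : D * (2 * N.+1)%:R / Q%:R < e / 3.
  rewrite ltr_pdivrMr// [ltRHS]mulrC -ltr_pdivrMr ?divr_gt0//.
  have /truncn_itv/andP[_] : 0 <= D * (2 * N.+1)%:R / (e / 3).
    by rewrite divr_ge0 ?mulr_ge0 ?divr_ge0 ?(ltW D0) ?(ltW e_gt0).
  exact.
pose code y := [ffun i : 'I_Q => Ordinal (clP (sel y (i%:R / Q%:R)))].
have code_eq y z : code y = code z -> extend p (y, z) < e.
  move=> yz; have [sy sizey by_] := sel_few_breakpoints y.
  have [sz sizez bz] := sel_few_breakpoints z.
  pose ind (k t : R) : R := (k <= t < k + Q%:R^-1)%R%:R.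
  have sind k : step (ind k) by exact: step_itvr.
  have [sS meanS] := mean_sum (sy ++ sz) sind.
  have sDS := step_comp (fun x => D * x) sS.
  apply: (@le_lt_trans _ _ (mean (fun t => e / 3 + D * \sum_(k <- sy ++ sz) ind k t))).
    apply: le_mean; [exact: psum_step|exact: (step_comp (fun x => e / 3 + x) sDS)|].
    move=> t /andP[t0 t1]; pose i := Num.truncn (t * Q%:R).
    have ind0 k : 0 <= ind k t by rewrite /ind; case: (_ <= _ < _).
    have /andP[it ti] : i%:R <= t * Q%:R < i.+1%:R.
      by apply: truncn_itv; rewrite mulr_ge0// ltW.
    have iQ : (i < Q)%N.
      by rewrite -(ltr_nat R); apply: le_lt_trans it _; rewrite gtr_pMl ?Q0.
    have it' : i%:R / Q%:R <= t by rewrite ler_pdivrMr.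
    have ti' : t < i%:R / Q%:R + Q%:R^-1.
      by rewrite -[X in _ + X]mul1r -mulrDl natr1 ltr_pdivlMr.
    have i0 : 0 <= i%:R / Q%:R :> R by rewrite divr_ge0 ?ler0n.
    have [/hasP[k bs /andP[ib bt]]|] :=
        boolP (has (fun k => i%:R / Q%:R < k <= t) (sy ++ sz)).
      apply: le_trans (eD _ _) _; rewrite (big_rem k)//= {1}/ind bt.
      have -> : (t < k + Q%:R^-1) by lra.
      have : 0 <= \sum_(j <- rem k (sy ++ sz)) ind j t by rewrite sumr_ge0.
      rewrite mulr1n => h; rewrite mulrDr mulr1; have := mulr_ge0 (ltW D0) h; lra.
    move=> /hasPn nb; change (psum p (sel y t, sel z t) <=
      e / 3 + D * \sum_(k <- sy ++ sz) ind k t).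
    have <- : sel y (i%:R / Q%:R) = sel y t.
      by apply: by_ => // k ks; apply: nb; rewrite mem_cat ks.
    have <- : sel z (i%:R / Q%:R) = sel z t.
      by apply: bz => // k ks; apply: nb; rewrite mem_cat ks orbT.
    rewrite ler_wpDr ?mulr_ge0 ?(ltW D0) ?sumr_ge0//; apply: ltW.
    apply: cl_eq; move/ffunP: yz => /(_ (Ordinal iQ)); rewrite !ffunE => h.
    exact: (congr1 val h).
  rewrite meanD ?mean_cst ?meanZ// ?meanS; last exact: step_cst.
  have : \sum_(k <- sy ++ sz) mean (ind k) <= (2 * N.+1)%:R / Q%:R.
    apply: (@le_trans _ _ (\sum_(k <- sy ++ sz) Q%:R^-1)).
      apply: ler_sum => k _; apply: le_trans (mean_itv_le _) _.
        by rewrite lerDl invr_ge0.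
      by rewrite addrAC subrr add0r.
    rewrite big_const_seq count_predT iter_addr_0 -[leLHS]mulr_natl.
    rewrite ler_wpM2r ?invr_ge0// ler_nat size_cat mul2n -addnn.
    exact: leq_add.
  move=> /(ler_wpM2l (ltW D0)); rewrite mulrA => h; lra.
have /choice[rep repP] c : exists y, (exists z, code z = c) -> code y = c.
  have [[z zc]|H] := pselect (exists z, code z = c); first by exists z.
  by exists (set_val a) => /H.
exists [set rep c | c in [set: {ffun 'I_Q -> 'I_(size s)}]].
  exact/finite_image/finite_finset.
move=> z; exists (rep (code z)); first by exists (code z).
by apply: code_eq; apply: repP; exists z.
Qed.

End TotallyBounded.

End Operator.

(** * Uniform structures and function space topologies *)

Section LinearUniform.
Variables (R : realType).

Lemma entourage_real (E : set (R * R)) :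
  entourage E <-> exists2 e, 0 < e & forall x y, `|x - y| < e -> E (x, y).
Proof.
rewrite -entourage_ballE; split.
  by move=> [e /= e0 eE]; exists e => // x y xy; exact: eE.
by move=> [e e0 eE]; exists e => // -[x y]; exact: eE.
Qed.

(** The topologies of pointwise, uniform and compact convergence are all given by
    uniform convergence on the sets of a family. So continuity of a linear
    operator reduces to bounding its values on a set A of one family by the
    values of its argument on a set B of the other. *)
Lemma linear_uniform_cvg (U V : choiceType) (L : (U -> R) -> (V -> R))
    (A : set V) (B : set U) :
  (forall f g : U -> R, L (f - g) = L f - L g) ->
  (forall f M, (forall x, B x -> `|f x| <= M) -> forall y, A y -> `|L f y| <= M) ->
  forall (F : set_system (U -> R)) (f : U -> R), Filter F ->
    {uniform B, F --> f} -> {uniform A, L @ F --> L f}.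
Proof.
move=> LB Lbd F f FF Ff P /uniform_nbhs[E [/entourage_real[e e0 eE] EP]].
have e2 : 0 < e / 2 by rewrite divr_gt0.
have : F [set h | forall x, B x -> `|f x - h x| < e / 2].
  apply: Ff; apply/uniform_nbhs; exists [set xy | `|xy.1 - xy.2| < e / 2].
  by split => //; apply/entourage_real; exists (e / 2).
move=> FB; change (F (L @^-1` P)); apply: filterS FB => h Bh; apply: (EP (L h)) => y Ay; apply: eE.
have := @Lbd (f - h) (e / 2) (fun x Bx => ltW (Bh x Bx)) y Ay.
by rewrite LB => h1; apply: (le_lt_trans h1); lra.
Qed.

Lemma ptws_uniform_finite (U : topologicalType) (F : set_system (U -> R))
    (f : U -> R) (s : seq U) : Filter F ->
  {ptws, F --> f} -> {uniform [set` s], F --> f}.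
Proof.
move=> FF; rewrite pointwise_cvg_family_singleton => /fam_cvgP Ff.
elim: s => [|x s IHs].
  by rewrite (_ : [set` _] = set0); [exact: cvg_uniform_set0|apply/seteqP; split].
rewrite (_ : [set` _] = [set x] `|` [set` s]).
  by apply: cvg_uniformU => //; apply: Ff; exists x.
by apply/seteqP; split => y /=; rewrite inE => /predU1P.
Qed.

End LinearUniform.

Section MetricSpaces.
Variable R : realType.

Lemma metric_space_metrizes (Z : choiceType) (q : Z * Z -> R) (qm : is_metric q) :
  @metrizes R (metric_space qm) q.
Proof.
move=> E; rewrite -entourage_ballE; split.
  by move=> [e /= e0 eE]; exists e => // x y xy; exact: eE.
by move=> [e e0 eE]; exists e => // -[x y]; exact: eE.
Qed.

Lemma metric_space_nbhs (Z : choiceType) (q : Z * Z -> R) (qm : is_metric q)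
    (z : metric_space qm) (A : set Z) :
  nbhs z A <-> exists2 r, 0 < r & forall w, q (z, w) < r -> A w.
Proof. by apply: metrizes_nbhs; exact: metric_space_metrizes. Qed.

Section Dominating.
Variables (Z : topologicalType) (dZ : Z * Z -> R).
Hypothesis nbhsZ : forall (z : Z) (A : set Z),
  nbhs z A <-> exists2 r, 0 < r & forall w, dZ (z, w) < r -> A w.
Variable q : Z * Z -> R.

Lemma dominatingP : dominating_metric q <-> is_metric q /\
  forall z e, 0 < e -> exists2 r, 0 < r & forall w, q (z, w) < r -> dZ (z, w) < e.
Proof.
split=> [[qm qc]|[qm qd]].
  split=> // z e e0; have /qc : nbhs z [set w | dZ (z, w) < e].
    by apply/nbhsZ; exists e.
  by move=> /metric_space_nbhs.
exists qm => z A /nbhsZ[e e0 eA]; have [r r0 rq] := qd z _ e0.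
by apply/metric_space_nbhs; exists r => // w /rq; exact: eA.
Qed.

Lemma continuous2P : continuous q <->
  forall y z e, 0 < e -> exists2 r, 0 < r & forall y' z',
    dZ (y, y') < r -> dZ (z, z') < r -> `|q (y', z') - q (y, z)| < e.
Proof.
split=> [qc y z e e0|qc [y z]].
  have /cvgrPdist_lt/(_ _ e0)[[A B] /= [/nbhsZ[r r0 rA] /nbhsZ[r' r'0 rB]] AB] := qc (y, z).
  exists (Num.min r r'); first by rewrite lt_min r0.
  move=> y' z'; rewrite !lt_min => /andP[yr _] /andP[_ zr].
  rewrite distrC; apply: (AB (y', z')); split; [exact: rA|exact: rB].
apply/cvgrPdist_lt => e e0; have [r r0 hr] := qc y z _ e0.
exists ([set w | dZ (y, w) < r], [set w | dZ (z, w) < r]).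
  by split; apply/nbhsZ; exists r.
by move=> [y' z'] [/= h1 h2]; rewrite distrC; exact: hr.
Qed.

End Dominating.

Lemma uniformly_dominatingP (Z : uniformType) (dZ : Z * Z -> R) (q : Z * Z -> R) :
  (forall E : set (Z * Z), entourage E <->
     exists2 r, 0 < r & forall y z, dZ (y, z) < r -> E (y, z)) ->
  uniformly_dominating_metric q <-> is_metric q /\
  forall e, 0 < e -> exists2 r, 0 < r & forall z w, q (z, w) < r -> dZ (z, w) < e.
Proof.
move=> entZ; split=> [[qm qc]|[qm qd]].
  split=> // e e0; have /qc : entourage [set yz | dZ yz < e].
    by apply/entZ; exists e.
  by move=> /metric_space_metrizes.
exists qm => E /entZ[e e0 eE]; have [r r0 rq] := qd _ e0.
by apply/metric_space_metrizes; exists r => // y z /rq; exact: eE.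
Qed.

(** A q-Cauchy filter is Cauchy for the uniformity, which q dominates, and its
    limit is a q-limit by continuity of q on the diagonal. *)
Lemma complete_uniformly_dominating (Z : uniformType) (dZ : Z * Z -> R)
    (q : Z * Z -> R) : metrizes dZ -> complete_uniformity Z -> continuous q ->
  uniformly_dominating_metric q -> complete_metric q.
Proof.
move=> entZ Zc qc qu; have nbhsZ := metrizes_nbhs entZ.
have [qm qd] := (uniformly_dominatingP q entZ).1 qu.
exists qm => F FF cF.
have [|z Fz] := Zc F FF.
  move=> E /entZ[e e0 eE]; apply: cF; apply/metric_space_metrizes.
  by have [r r0 hr] := qd _ e0; exists r => // y z /hr; exact: eE.
exists z => A /metric_space_nbhs[r r0 rA]; apply: Fz; apply/nbhsZ.
have [s s0 hs] := (continuous2P nbhsZ q).1 qc z z r r0.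
exists s => // w zw; apply: rA.
have zz : dZ (z, z) < s.
  have : nbhs z [set w | dZ (z, w) < s] by apply/nbhsZ; exists s.
  exact: nbhs_singleton.
have := hs z w zz zw; rewrite (pseudometric_refl qm) subr0; apply: le_lt_trans.
exact: ler_norm.
Qed.

End MetricSpaces.

Section OperatorTopology.
Variables (R : realType) (Y : uniformType) (d : Y * Y -> R) (X : set Y).
Hypotheses (dm : is_pseudometric d) (d1 : forall z, d z <= 1).
Hypothesis dY : metrizes d.
Local Notation delta := (dist d X).
Hypothesis Xpos : forall y, ~ X y -> 0 < delta y.
Variables (lam : nat -> Y -> R) (alpha : nat -> Y -> X).
Hypothesis anch : anchored d lam alpha.
Variables a b : X.
Local Notation sel := (sel d lam alpha).
Local Notation T := (extend d lam alpha a b).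

Definition anchors_of (K : set Y) : set X :=
  [set x | exists2 y, K y & exists2 t, 0 <= t < 1 & sel y t = inl x].

(** Along an ultrafilter of anchors the points they serve converge in K; if
    the limit is outside X, then only finitely many anchors are used near it,
    and if it is in X, then the anchors converge to it as well. *)
Lemma compact_anchors (K : set Y) : compact K -> compact (anchors_of K).
Proof.
rewrite compact_ultra => cK; rewrite compact_ultra => F UF FG.
have /choice[f fP] (x : X) : exists y, anchors_of K x ->
    K y /\ exists2 t, 0 <= t < 1 & sel y t = inl x.
  have [[y Ky h]|H] := pselect (anchors_of K x); first by exists y.
  by exists (set_val a) => /H.
have UfF : UltraFilter (f @ F).
  split=> [|G PG sG]; first exact: fmap_proper_filter.
  rewrite predeqE => A; split=> [GA|]; last exact: sG.
  have [//|FA] := in_ultra_setVsetC (f @^-1` A) UF.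
  have : G (A `&` ~` A) by apply: filterI => //; exact: sG.
  by rewrite setICr => /filter_not_empty.
have fK : (f @ F) K.
  by change (F (f @^-1` K)); apply: filterS FG => x /fP[].
have [y [Ky Fy]] := cK _ UfF fK.
have [Xy|Xy] := pselect (X y).
  pose x : X := SigSub (mem_set Xy).
  exists x; split.
    exists y => //; exists 0; first by rewrite lexx ltr01.
    exact: (sel_in d lam alpha x).
  move=> A /(metrizes_nbhs_sub dY)[r r0 rA].
  have : F (f @^-1` [set z | d (y, z) < r / 7]).
    by apply: Fy; apply/(metrizes_nbhs dY); exists (r / 7) => //; rewrite divr_gt0.
  move=> /(filterI FG); apply: filterS => x' [Gx' /= yx'].
  have [_ [t ht sx']] := fP _ Gx'; apply: rA.
  change (d (y, set_val x') < r).
  have := sel_near dm anch ht sx'; have := dist_le dm (f x') Xy.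
  have := pseudometric_triangle dm (f x') y (set_val x').
  rewrite (pseudometric_sym dm (f x') y); lra.
have [s [r r0 hr]] := local_anchors dm Xpos anch a Xy.
have Fs : F ([set` s] `&` anchors_of K).
  have : F (f @^-1` [set z | d (y, z) < r]).
    by apply: Fy; apply/(metrizes_nbhs dY); exists r.
  move=> /(filterI FG); apply: filterS => x' [Gx' /= yx']; split=> //.
  have [_ [t ht sx']] := fP _ Gx'; have [_ h] := hr _ yx'.
  exact: h sx'.
have cs : compact ([set` s] `&` anchors_of K).
  by apply/finite_compact/finite_setIl; exact: finite_seq.
move: cs; rewrite compact_ultra => /(_ F UF Fs)[x [[_ Gx] Fx]].
by exists x.
Qed.

Lemma extend_sub (p q : X * X -> R) : T (p - q) = T p - T q.
Proof.
have := extend_linear anch a b (-1) q p; rewrite !scaleN1r addrC => ->.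
by rewrite addrC.
Qed.

Lemma extend_uniform_cvg (A : set (Y * Y)) (S : set X) : S a -> S b ->
  (forall z, A z -> forall t x, 0 <= t < 1 ->
     (sel z.1 t = inl x -> S x) /\ (sel z.2 t = inl x -> S x)) ->
  forall (F : set_system (X * X -> R)) (p : X * X -> R), Filter F ->
    {uniform (S `*` S), F --> p} -> {uniform A, T @ F --> T p}.
Proof.
move=> Sa Sb AS; apply: linear_uniform_cvg; first exact: extend_sub.
move=> p M pM [y z] Ayz; apply: (extend_bound dm d1 anch Sa Sb).
- by move=> x x' Sx Sx'; exact: (pM (x, x')).
- by move=> t x ht; have [h _] := AS _ Ayz t x ht.
- by move=> t x ht; have [_ h] := AS _ Ayz t x ht.
Qed.

Lemma extend_continuous_uniform :
  continuous (T : {uniform X * X -> R} -> {uniform Y * Y -> R}).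
Proof.
move=> p.
have FF : Filter (nbhs (p : {uniform X * X -> R})) by exact: nbhs_filter.
apply: (extend_uniform_cvg (A := setT) (S := setT) _ _ _ FF) => //.
by rewrite (_ : setT `*` setT = setT)//; exact/seteqP.
Qed.

Lemma extend_continuous_ptws :
  continuous (T : {ptws X * X -> R} -> {ptws Y * Y -> R}).
Proof.
move=> p; change {ptws, T @ nbhs (p : {ptws X * X -> R}) --> T p}.
rewrite pointwise_cvg_family_singleton; apply/fam_cvgP => _ [[y z] _ <-].
have [F [Fy _]] := sel_finite_near dm Xpos anch a y.
have [G [Gz _]] := sel_finite_near dm Xpos anch a z.
have [s [sa sb sP]] : exists s : seq X,
    [/\ a \in s, b \in s & forall x, inl x \in F ++ G -> x \in s].
  exists ([:: a; b] ++ pmap (fun u => if u is inl x then Some x else None) (F ++ G)).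
  split=> [||x h]; rewrite mem_cat ?inE ?eqxx ?orbT//; apply/orP; right.
  by rewrite mem_pmap; apply/mapP; exists (inl x).
have FF : Filter (nbhs (p : {ptws X * X -> R})) by exact: nbhs_filter.
apply: (extend_uniform_cvg (S := [set` s]) _ _ _ FF).
- exact: sa.
- exact: sb.
- move=> _ -> t x ht /=; split=> E; apply: sP; rewrite mem_cat -E.
    by rewrite Fy.
  by rewrite Gz ?orbT.
rewrite (_ : _ `*` _ = [set` allpairs pair s s]).
  by apply: ptws_uniform_finite => //; exact: cvg_id.
apply/seteqP; split=> [[x x'] [xs x's]|[x x']] /=.
  exact: (@allpairs_f _ _ _ pair).
by move=> /allpairsP[[u v] [? ? [-> ->]]].
Qed.

Lemma extend_continuous_compact : continuous
  (T : {family compact, X * X -> R} -> {family compact, Y * Y -> R}).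
Proof.
move=> p.
have FF : Filter (nbhs (p : {family compact, X * X -> R})) by exact: nbhs_filter.
change {family compact, T @ nbhs (p : {family compact, X * X -> R}) --> T p}.
apply/(@fam_cvgP _ _ compact) => A cA.
pose K := (fst @` A) `|` (snd @` A).
have cK : compact K.
  by apply: compactU; apply: continuous_compact => //;
    apply: continuous_subspaceT => z; [exact: cvg_fst|exact: cvg_snd].
pose S := [set a] `|` ([set b] `|` anchors_of K).
have cS : compact S.
  apply: compactU; first exact: compact_set1.
  by apply: compactU; [exact: compact_set1|exact: compact_anchors].
apply: (extend_uniform_cvg (S := S) _ _ _ FF).
- by left.
- by right; left.
- move=> z Az t x ht; split=> E; right; right.
    by exists z.1; [left; exists z|exists t].
  by exists z.2; [right; exists z|exists t].
have : {family compact, nbhs (p : {family compact, X * X -> R}) --> p} by exact: cvg_id.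
by move=> /(@fam_cvgP _ _ compact); apply; exact: compact_setX.
Qed.

End OperatorTopology.

(** * The theorem *)

Section TruncatedMetric.
Variables (R : realType) (Y : uniformType) (d0 : Y * Y -> R).
Hypothesis dm0 : is_metric d0.

Definition truncated (z : Y * Y) : R := Num.min (d0 z) 1.

Lemma truncated_le1 z : truncated z <= 1.
Proof. by rewrite /truncated ge_min lexx orbT. Qed.

Lemma truncated_metric : is_metric truncated.
Proof.
have d0_ge0 := pseudometric_ge0 dm0; rewrite /truncated; split; first split.
- by move=> x y; rewrite le_min d0_ge0 ler01.
- by move=> x; rewrite (pseudometric_refl dm0) min_l.
- by move=> x y; rewrite (pseudometric_sym dm0).
- move=> y x z; have := pseudometric_triangle dm0 y x z.
  have := d0_ge0 x y; have := d0_ge0 y z.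
  by case: (leP (d0 (x, z)) 1) => ?; case: (leP (d0 (x, y)) 1) => ?;
    case: (leP (d0 (y, z)) 1) => ?; lra.
- move=> x y h; apply: (metric_separated dm0).
  by move: h; case: leP => // _ /eqP; rewrite oner_eq0.
Qed.

Lemma truncated_metrizes : metrizes d0 -> metrizes truncated.
Proof.
move=> d0Y E; split=> [/d0Y[r r0 rE]|[r r0 rE]].
  exists (Num.min r 1); first by rewrite lt_min r0 ltr01.
  move=> y z; rewrite /truncated !lt_min !gt_min ltxx !orbF => /andP[h1 h2].
  by apply: rE; case/orP: h1 => // h1; apply: lt_trans h1.
apply/d0Y; exists r => // y z yz; apply: rE.
by rewrite /truncated gt_min yz.
Qed.

End TruncatedMetric.

Theorem theorem2 (R : realType) (Y : uniformType) (X : set Y)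
  (Ymetrizable : metrizable R Y) (Xclosed : closed X)
  (Xge2 : exists x x' : Y, [/\ X x, X x' & x <> x']) :
  exists T : {linear (X * X -> R) -> (Y * Y -> R)},
    [/\
      (forall p : X * X -> R, (forall z, 0 <= p z) -> forall z, 0 <= T p z),
      (forall (p : X * X -> R) (x x' : X), T p (set_val x, set_val x') = p (x, x')),
      [/\
        (forall c : R, T (cst c) = cst c),
        preserves (@bounded_function R (X * X)) (@bounded_function R (Y * Y)) T,
        preserves (fun p : X * X -> R => continuous p)
                  (fun q : Y * Y -> R => continuous q) T,
        preserves (@is_pseudometric R X) (@is_pseudometric R Y) T &
        preserves (@is_metric R X) (@is_metric R Y) T] /\
      [/\
        preserves (@admissible_metric R (set_type X)) (@admissible_metric R Y) T,
        preserves (@dominating_metric R (set_type X)) (@dominating_metric R Y) T &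
        preserves (@uniformly_dominating_metric R (set_type X))
                  (@uniformly_dominating_metric R Y) T],
      [/\
        continuous (T : {ptws X * X -> R} -> {ptws Y * Y -> R}),
        continuous (T : {uniform X * X -> R} -> {uniform Y * Y -> R}) &
        continuous
          (T : {family compact, X * X -> R} -> {family compact, Y * Y -> R})] &
      (complete_uniformity Y ->
        preserves
          (fun p : X * X -> R =>
            [/\ complete_metric p, continuous p & uniformly_dominating_metric p])
          (fun q : Y * Y -> R =>
            [/\ complete_metric q, continuous q & uniformly_dominating_metric q])
          T) /\
      (totally_bounded_uniformity Y -> finite_covering_dim (set_type (~` X)) ->
        preserves (@totally_bounded_pseudometric R X)
                  (@totally_bounded_pseudometric R Y) T)].
Proof.
have [d0 [dm0 entY]] := Ymetrizable.
have d0Y : metrizes d0 by rewrite /metrizes entY; exact: metric_space_metrizes.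
have dmet := truncated_metric dm0; have d1 := truncated_le1 d0.
have dY := truncated_metrizes d0Y; set d := truncated d0 in dmet d1 dY.
have dm : is_pseudometric d := dmet.
have [a0 [b0 [Xa0 Xb0 ab0]]] := Xge2.
pose a : X := SigSub (mem_set Xa0); pose b : X := SigSub (mem_set Xb0).
have ab : a <> b by move=> h; apply: ab0; change (set_val a = set_val b); rewrite h.
have Xpos y : ~ X y -> 0 < dist d X y by exact: metrizes_closed_dist.
(* One operator must have all the properties, so the anchors of bounded
   multiplicity are chosen whenever they exist. *)
have [lam [alpha [anch mult]]] : exists lam (alpha : nat -> Y -> X),
    anchored d lam alpha /\
    (totally_bounded_uniformity Y -> finite_covering_dim (set_type (~` X)) ->
     exists N, multiplicity_le X lam N).
  have [[Ytb [n Xdim]]|H] := pselect (totally_bounded_uniformity Y /\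
      finite_covering_dim (set_type (~` X))); last first.
    have [lam [alpha anch]] := anchored_exists dm d1 Xpos a.
    by exists lam, alpha; split => // Ytb Xdim; exfalso; apply: H.
  have [lam [alpha [anch mult]]] := anchored_multiplicity dm d1 Xpos a
    (small_cover dm dY Xclosed Ytb Xdim).
  by exists lam, alpha; split => // _ _; exists (3 * n.+1)%N.
have nbhsY := metrizes_nbhs dY.
have nbhsX (x : X) (A : set X) := metrizes_nbhs_sub dY x A.
have entX := metrizes_entourage_sub dY (X := X).
pose T0 := extend d lam alpha a b.
have pos (p : X * X -> R) : is_metric p -> 0 < p (a, b).
  move=> pm; rewrite lt_neqAle (pseudometric_ge0 pm) andbT eq_sym.
  by apply/eqP => /(metric_separated pm).
have Tm p : is_metric p -> is_metric (T0 p).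
  move=> pm; split; first exact: (extend_pseudometric dm d1 anch a b pm).
  move=> y z; exact: (extend_separated dm d1 Xpos anch pm (pos _ pm) (metric_separated pm)
    (metric_separated dmet)).
have Tcont (p : X * X -> R) : continuous p -> continuous (T0 p).
  move=> /(continuous2P (dZ := fun z => d (set_val z.1, set_val z.2)) nbhsX) pc.
  by apply/(continuous2P nbhsY); exact: (extend_continuous dm d1 Xpos anch a b pc).
have Tdom p : @dominating_metric R (set_type X) p -> dominating_metric (T0 p).
  move=> /(dominatingP (dZ := fun z => d (set_val z.1, set_val z.2)) nbhsX)[pm pd].
  apply/(dominatingP nbhsY); split; first exact: Tm.
  exact: (extend_dominating dm d1 Xpos anch pm (pos _ pm) pd).
have Tudom p : @uniformly_dominating_metric R (set_type X) p ->
    uniformly_dominating_metric (T0 p).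
  move=> /(uniformly_dominatingP (dZ := fun z => d (set_val z.1, set_val z.2)) _ entX)[pm pd].
  apply/(uniformly_dominatingP _ dY); split; first exact: Tm.
  exact: (extend_uniformly_dominating dm d1 anch pm (pos _ pm) pd).
have Tlin : linear T0 by move=> k p q; exact: extend_linear.
pose T1 : {linear (X * X -> R) -> (Y * Y -> R)} :=
  HB.pack T0 (GRing.isLinear.Build R (X * X -> R) (Y * Y -> R) *:%R T0 Tlin).
exists T1; split.
- by move=> p p0 z; exact: (extend_ge0 dm d1).
- by move=> p x x'; exact: extend_extends.
- split; split.
  + exact: extend_cst.
  + move=> p [M pM]; exists M => -[y z].
    apply: (extend_bound dm d1 anch (S := setT)) => // x x' _ _; exact: pM.
  + exact: Tcont.
  + by move=> p pm; exact: (extend_pseudometric dm d1 anch a b pm).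
  + exact: Tm.
  + by move=> p [pd pc]; split; [exact: Tdom|exact: Tcont].
  + exact: Tdom.
  + exact: Tudom.
- split.
  + exact: (extend_continuous_ptws dm d1 Xpos anch).
  + exact: (extend_continuous_uniform dm d1 anch).
  + exact: (extend_continuous_compact dm d1 dY Xpos anch).
split.
  move=> Yc p [_ pc pu]; have qc := Tcont _ pc; have qu := Tudom _ pu.
  by split => //; exact: (complete_uniformly_dominating dY Yc qc qu).
move=> Ytb Xdim p; have [N lamN] := mult Ytb Xdim.
apply: (extend_totally_bounded dm d1 anch a b lamN); split => // e e0.
have [|C finC hC] := Ytb [set yz | d yz < e]; first by apply/dY; exists e.
by exists C.
Qed.
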